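(* The Steiner symmetrization $\mathfrak{S}$ and the Brownian symmetrization $\mathfrak{B}$ are different transformations: there exists a bounded domain $U\subset\mathbb{C}$ containing the origin such that $\mathfrak{B}(U)\neq\mathfrak{S}(U)$.
   Context: A domain is a nonempty connected open subset of $\mathbb{C}$. $\mathbb{D}$ is the open unit disc. Brownian symmetrization. Let $U\subset\mathbb{C}$ be a bounded domain containing $0$. Let $(Z_t)_{t\ge 0}$ be a standard planar Brownian motion started at $0$, let $\tau=\tau_U=\inf\{t\ge 0: Z_t\notin U\}$ be its exit time from $U$, and let $\mu$ be the distribution of $\Re(Z_\tau)$ (a compactly supported, mean-zero probability measure on $\mathbb{R}$). Let $F$ be the cumulative distribution function of $\mu$ and $G_\mu(u)=\inf\{x\in\mathbb{R}: F(x)\ge u\}$ for $u\in(0,1)$ its quantile function. Put $\varphi(\theta)=G_\mu(|\theta|/\pi)$ for $\theta\in(-\pi,\pi)$ with $\theta\neq0$, and for $n\ge 1$ let $\widehat{\varphi}(n)=\frac{2}{\pi}\int_0^\pi G_\mu(\theta/\pi)\cos(n\theta)\,d\theta$. Define $\psi(z)=\sum_{n=1}^\infty \widehat{\varphi}(n)z^n$ for $z\in\mathbb{D}$ (this map is known to be univalent on $\mathbb{D}$). The Brownian symmetrization of $U$ is $\mathfrak{B}(U)=\psi(\mathbb{D})$ (the Gross domain generated from $\mu$). Steiner symmetrization (with respect to the real axis). For a bounded domain $U\subset\mathbb{C}$ containing $0$ and $x\in\mathbb{R}$, let $L_x=\{z:\Re(z)=x\}$ and let $\ell_x$ be the length (one-dimensional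 Lebesgue measure) of $L_x\cap U$. Then $\mathfrak{S}(U)=\bigcup_{z\in U}\{\Re(z)+i\,t\,\ell_{\Re(z)}: -\tfrac12<t<\tfrac12\}$. *)

(* Defs.v *)
From HB Require Import structures.
From mathcomp Require Import all_boot all_order all_algebra complex.
From mathcomp Require Import all_classical all_reals all_analysis.

Set Implicit Arguments.
Unset Strict Implicit.
Unset Printing Implicit Defensive.

Import Order.TTheory GRing.Theory Num.Theory.
Import numFieldNormedType.Exports.

Local Open Scope classical_set_scope.
Local Open Scope ring_scope.
Local Open Scope complex_scope.

(* The alias [R[i]^o] carries the usual (modulus) topology of the complex
   plane as an instance of the generic one on [numFieldType]s. *)
Definition is_domain (R : realType) (U : set R[i]^o) : Prop :=
  [/\ U !=set0, open U & connected U].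

Definition unit_disc (R : realType) : set R[i]^o := [set z | `|z| < 1].

(* Real-valued processes are indexed by R, but only times t >= 0 are used. *)

(* Quantifying over all families of Borel sets, including [setT], yields the
   product rule for every subfamily. *)
Definition mutually_independent (R : realType) (d : measure_display)
    (T : measurableType d) (P : probability T R)
    (n : nat) (V : 'I_n -> T -> R) : Prop :=
  forall A : 'I_n -> set R, (forall i, measurable (A i)) ->
    P (\bigcap_(i in [set: 'I_n]) (V i @^-1` A i)) =
    (\prod_(i < n) P (V i @^-1` A i))%E.

(* Sample paths are continuous everywhere on the probability space, not just
   almost everywhere, so that exit positions are measurable without
   completing [P]; the second argument of [normal_prob] is the standard
   deviation. *)
Definition is_brownian_motion (R : realType) (d : measure_display)
    (T : measurableType d) (P : probability T R) (X : R -> T -> R) : Prop :=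
  [/\ forall t, 0 <= t -> measurable_fun [set: T] (X t),
      forall w, X 0 w = 0,
      forall w, {within `[0, +oo[, continuous (fun t => X t w)},
      forall (n : nat) (t : nat -> R), 0 <= t 0%N -> nondecreasing_seq t ->
        mutually_independent P
          (fun (i : 'I_n) w => X (t i.+1) w - X (t i) w)
    & forall s t, 0 <= s -> s < t -> forall A : set R, measurable A ->
        pushforward P (fun w => X t w - X s w) A =
        normal_prob 0 (Num.sqrt (t - s)) A].

Definition process_sigma (R : realType) (d : measure_display)
    (T : measurableType d) (X : R -> T -> R) : set (set T) :=
  <<s [set A | exists t, exists B : set R,
         [/\ 0 <= t, measurable B & A = X t @^-1` B]] >>.

Definition independent_processes (R : realType) (d : measure_display)
    (T : measurableType d) (P : probability T R) (X Y : R -> T -> R) : Prop :=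
  forall A B : set T, process_sigma X A -> process_sigma Y B ->
    P (A `&` B) = (P A * P B)%E.

Definition is_planar_brownian_motion (R : realType) (d : measure_display)
    (T : measurableType d) (P : probability T R) (Z : R -> T -> R[i]) : Prop :=
  let X t w := complex.Re (Z t w) in
  let Y t w := complex.Im (Z t w) in
  [/\ is_brownian_motion P X, is_brownian_motion P Y
    & independent_processes P X Y].

(* [inf set0 = 0]: on paths that never leave U (a null event when U is
   bounded) the exit time takes the dummy value 0. *)
Definition exit_time (R : realType) (T : Type) (Z : R -> T -> R[i])
    (U : set R[i]^o) (w : T) : R :=
  inf [set t | 0 <= t /\ ~ U (Z t w)].

Definition exit_law (R : realType) (d : measure_display)
    (T : measurableType d) (P : probability T R) (Z : R -> T -> R[i])
    (U : set R[i]^o) : set R -> \bar R :=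
  pushforward P (fun w => complex.Re (Z (exit_time Z U w) w)).

Definition quantile (R : realType) (mu : set R -> \bar R) (u : R) : R :=
  inf [set x | (u%:E <= mu `]-oo, x]%classic)%E].

Definition gross_coef (R : realType) (mu : set R -> \bar R) (n : nat) : R :=
  2 / pi * Rintegral lebesgue_measure `]0, pi[
             (fun theta => quantile mu (theta / pi) * cos (n%:R * theta)).

Definition gross_map (R : realType) (mu : set R -> \bar R) (z : R[i]^o) :
    R[i]^o :=
  limn (fun N => \sum_(1 <= n < N) ((gross_coef mu n)%:C * z ^+ n : R[i]^o)).

Definition gross_domain (R : realType) (mu : set R -> \bar R) : set R[i]^o :=
  gross_map mu @` @unit_disc R.

Definition brownian_symmetrization (R : realType) (d : measure_display)
    (T : measurableType d) (P : probability T R) (Z : R -> T -> R[i])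
    (U : set R[i]^o) : set R[i]^o :=
  gross_domain (exit_law P Z U).

Definition vertical_length (R : realType) (U : set R[i]^o) (x : R) : \bar R :=
  lebesgue_measure [set y : R | U (x +i* y)].

Definition steiner_symmetrization (R : realType) (U : set R[i]^o) :
    set R[i]^o :=
  \bigcup_(z in U)
    [set complex.Re z +i* (t * fine (vertical_length U (complex.Re z)))
       | t in `](- 2^-1), 2^-1[ ].

(* Main.v *)
Require Import Defs.
From HB Require Import structures.
From mathcomp Require Import all_boot all_order all_algebra complex.
From mathcomp Require Import all_classical all_reals all_analysis.
From mathcomp Require Import measurable_realfun ring lra.

(** The domain is the square of points with both coordinates of modulus less
    than 1, cut along the two slits at height h and -h that run from the left
    side to abscissa 1/2. Steiner symmetrization does not see horizontal slits:
    each meets a vertical line in at most one point, so the symmetrized domain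
    contains every point with both coordinates of modulus at most 1/2.
    Brownian motion does see them. When h is tiny, the path started at 0
    leaves the strip between the slits before its real part has moved, so the
    law of the real part of the exit position has almost all its mass near 0.
    It remains to see that the Gross domain of such a law misses a point with
    both coordinates of modulus at most 1/2 ([gross_domain_misses]).

    The Gross map psi has real coefficients a_n, the cosine coefficients of a
    nondecreasing function phi on (0, pi). Two facts about it are opposed.

    First, phi is a superposition of increasing step functions. Hence pairing
    its coefficients with a sine polynomial that is nonnegative on [0, pi]
    gives a quantity of constant sign ([cos_coef_pairing]). Applied to the
    polynomial with coefficients Re ((1 - z^2) z^(n-1)), which is close to
    sin x times the real part of (1 - z^2) / (1 - 2 z cos x + z^2), a positive
    number, this bounds the real part of (1 - z^2) psi'(z) by a negative
    constant that depends on |z| ([Re_derivative_le]). In the coordinate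
    log ((1 + z) / (1 - z)) the disc becomes a convex strip and
    (1 - z^2) psi'(z) becomes twice the derivative of psi, so psi is injective
    by the mean value theorem along segments. As psi already moves by a
    definite amount at the start of each segment, more is true: psi(w) stays
    at a positive distance from psi(z) when w tends to the circle and z is
    fixed ([psi_separation]).

    Secondly, a_n is bounded both by |a_1| and by 2/n, and a_1 is small because
    phi is small off a set of small measure. So the sum of the squares of the
    a_n is small, and on every circle of centre 0 some point has an image of
    modulus at most 1/2 ([cos_series_small_point]). As the radius tends to 1,
    these images accumulate at a point of the square, which by the
    separation property is not a value of psi ([cos_series_misses]).

    The probabilistic estimates come from the Gaussian law of increments. At a
    fixed time t much larger than h^2, the imaginary part is of modulus less
    than h with small probability ([bm_center]); up to time t, the real part
    stays small by a union bound over the increments on all dyadic grids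
    ([some_big_jump_le], [path_bound]). Off these two events the path has hit
    a slit near the imaginary axis. Passing from these events to the exit law
    requires the exit position to be measurable ([stopped_value_measurable]). *)

Import Order.TTheory GRing.Theory Num.Theory.
Import numFieldNormedType.Exports.

Set Implicit Arguments.
Unset Strict Implicit.
Unset Printing Implicit Defensive.

Local Open Scope classical_set_scope.
Local Open Scope ring_scope.
Local Open Scope complex_scope.

Local Notation normc := ComplexField.Normc.normc.

(** * Integrating a derivative against a monotone function *)

Lemma Rintegral_derivative_itv (R : realType) (K k : R -> R) (a b : R) (c d : bool) :
  (forall x : R, is_derive x 1 K (k x)) -> continuous k -> a <= b ->
  Rintegral lebesgue_measure [set` Interval (BSide c a) (BSide d b)] k = K b - K a.
Proof.
move=> dK ck; rewrite le_eqVlt => /predU1P[<-|ab].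
  rewrite subrr; apply/eqP; rewrite /Rintegral.
  rewrite integral_itv_bndoo; first by rewrite set_itvoo0 integral_set0.
  apply/measurable_EFinP; apply: measurable_funTS.
  exact: continuous_measurable_fun.
have mk : measurable_fun `]a, b[ (EFin \o k).
  apply/measurable_EFinP; apply: measurable_funTS.
  exact: continuous_measurable_fun.
have cK : continuous K.
  move=> x; apply: differentiable_continuous; apply/derivable1_diffP.
  exact: (@ex_derive _ _ _ _ _ _ _ (dK x)).
rewrite /Rintegral integral_itv_bndoo// -(@integral_itv_bndoo _ _ _ _ true false)//.
rewrite (@continuous_FTC2 _ k K)//.
- exact: continuous_subspaceT.
- split.
  + by move=> x _; exact: (@ex_derive _ _ _ _ _ _ _ (dK x)).
  + by apply: cvg_at_right_filter; exact: cK.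
  + by apply: cvg_at_left_filter; exact: cK.
- by move=> x _; rewrite derive1E; exact: (@derive_val _ _ _ _ _ _ _ (dK x)).
Qed.

(** An up-set of an interval is a final segment, open or closed at its left
    end, and only that end point matters for the integral. *)
Lemma Rintegral_derivative_upset (R : realType) (K k : R -> R) (a b : R)
    (J : set R) :
  (forall x : R, is_derive x 1 K (k x)) -> continuous k -> a <= b ->
  J `<=` `]a, b[ -> (forall x y, J x -> x <= y -> y < b -> J y) ->
  exists2 s, a <= s <= b & Rintegral lebesgue_measure J k = K b - K s.
Proof.
move=> dK ck ab Jab Jup.
have [[x0 Jx0]|/set0P/negP/negPn/eqP J0] := pselect (J !=set0); last first.
  by exists b; rewrite ?ab ?lexx// J0 Rintegral_set0 subrr.
have lJ : lbound J a by move=> x /Jab /=; rewrite in_itv/= => /andP[/ltW].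
have hJ : has_lbound J by exists a.
have aJ : a <= inf J by apply: lb_le_inf => //; exists x0.
have Jb : inf J < b.
  apply: (@le_lt_trans _ _ x0); first exact: ge_inf.
  by move: (Jab _ Jx0) => /=; rewrite in_itv/= => /andP[].
exists (inf J); first by rewrite aJ ltW.
have [Js|Js] := pselect (J (inf J)).
  suff E : J = `[inf J, b[%classic.
    by rewrite [in LHS]E Rintegral_derivative_itv// ltW.
  apply/seteqP; split=> x /=; rewrite in_itv/=.
    by move=> Jx; rewrite ge_inf//=; move: (Jab _ Jx); rewrite /= in_itv/= => /andP[].
  by move=> /andP[sx xb]; exact: (Jup _ _ Js).
suff E : J = `]inf J, b[%classic.
    by rewrite [in LHS]E Rintegral_derivative_itv// ltW.
apply/seteqP; split=> x /=; rewrite in_itv/=.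
  move=> Jx; rewrite lt_neqAle ge_inf// andbT; apply/andP; split.
    by apply/negP => /eqP sx; apply: Js; rewrite sx.
  by move: (Jab _ Jx); rewrite /= in_itv/= => /andP[].
move=> /andP[sx xb].
have [|y Jy yx] := inf_lt _ sx; first by exists x0.
by apply: (Jup _ _ Jy) => //; exact: ltW.
Qed.

(** Each integer level below y contributes 1, so the sum is y rounded up. *)
Lemma sum_indicator_lt (R : realType) (m : nat) (y : R) : 0 <= y <= m%:R ->
  `|y - \sum_(j < m) (j%:R < y)%R%:R| <= 1.
Proof.
elim: m y => [|m IH] y /andP[y0 ym].
  by rewrite big_ord0 subr0 ger0_norm//; lra.
rewrite big_ord_recr/=; have [my|ym'] := ltP m%:R y; last first.
  by rewrite addr0 IH// y0.
rewrite (eq_bigr (fun=> 1)); last first.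
  move=> i _; rewrite (_ : _ < _ = true)//.
  by apply: le_lt_trans my; rewrite ler_nat ltnW.
rewrite sumr_const card_ord ler_norml; move: ym; rewrite -natr1 => ym.
by apply/andP; split; rewrite ?mulr1n; lra.
Qed.

(** The values of the sum are those of a staircase with m steps of height 2/m
    between -1 and 1. Composed with a monotone function, its steps are
    indicators of up-sets. *)
Lemma layer_approx (R : realType) (m : nat) (x : R) : (0 < m)%N -> -1 <= x <= 1 ->
  `|x - (\sum_(j < m) 2 / m%:R * (-1 + 2 / m%:R * j%:R < x)%R%:R - 1)| <= 2 / m%:R.
Proof.
move=> m0 /andP[x1 x2]; have m0' : 0 < m%:R :> R by rewrite ltr0n.
rewrite -mulr_sumr.
have := @sum_indicator_lt R m ((x + 1) * (m%:R / 2)).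
have -> : 0 <= (x + 1) * (m%:R / 2) <= m%:R by apply/andP; split; nra.
move=> /(_ isT) H.
rewrite (eq_bigr (fun j : 'I_m => (j%:R < (x + 1) * (m%:R / 2))%R%:R)); last first.
  move=> j _; congr (nat_of_bool _)%:R.
  rewrite -ltrBrDl opprK mulrC mulrA ltr_pdivrMr// mulrC.
  by apply/idP/idP => h; lra.
have -> : x - (2 / m%:R * \sum_(j < m) (j%:R < (x + 1) * (m%:R / 2))%R%:R - 1) =
  2 / m%:R * ((x + 1) * (m%:R / 2) - \sum_(j < m) (j%:R < (x + 1) * (m%:R / 2))%R%:R).
  by field; lra.
rewrite normrM ger0_norm; last by rewrite divr_ge0// ltW.
by rewrite ler_piMr// divr_ge0// ltW.
Qed.

Section IntegrableReal.
Context d (T : measurableType d) (R : realType) (mu : {measure set T -> \bar R}).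
Variables (D : set T) (mD : measurable D).

Lemma integrable_scale (c : R) (f : T -> R) : mu.-integrable D (EFin \o f) ->
  mu.-integrable D (EFin \o (fun x => c * f x)).
Proof. by move=> /(integrableZl mD c); apply: eq_integrable. Qed.

Lemma integrable_add (f g : T -> R) : mu.-integrable D (EFin \o f) ->
  mu.-integrable D (EFin \o g) -> mu.-integrable D (EFin \o (fun x => f x + g x)).
Proof. by move=> fI gI; have := integrableD mD fI gI; apply: eq_integrable. Qed.

Lemma integrable_sub (f g : T -> R) : mu.-integrable D (EFin \o f) ->
  mu.-integrable D (EFin \o g) -> mu.-integrable D (EFin \o (fun x => f x - g x)).
Proof. by move=> fI gI; have := integrableB mD fI gI; apply: eq_integrable. Qed.

End IntegrableReal.

Section KeyLemma.
Variables (R : realType).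
Local Notation mu := (@lebesgue_measure R).

Lemma continuous_itv_integrable (k : R -> R) (a b : R) :
  continuous k -> mu.-integrable `]a, b[ (EFin \o k).
Proof.
move=> ck; apply: (@integrableS _ _ _ mu `[a, b]%classic `]a, b[%classic) => //.
  by apply: subset_itvW.
apply: continuous_compact_integrable; first exact: segment_compact.
exact: continuous_subspaceT.
Qed.

Lemma monotone_itv_integrable (phi k : R -> R) (a b : R) :
  {homo phi : x y / x <= y} -> (forall x, `|phi x| <= 1) -> continuous k ->
  mu.-integrable `]a, b[ (EFin \o (fun x => phi x * k x)).
Proof.
move=> phi_nd phi1 ck.
have : mu.-integrable `]a, b[ ((EFin \o phi) \* (EFin \o k))%E.
  apply: integrableMr => //; last exact: continuous_itv_integrable.
    exact: nondecreasing_measurable.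
  by exists 1; split => // M M1 x _; exact: le_trans (phi1 x) (ltW M1).
by apply: eq_integrable.
Qed.

(** A form of integration by parts for a monotone phi without a Stieltjes
    integral: phi is uniformly close to a combination of indicators of up-sets
    with total weight 2, and the integral of K' over an up-set is the opposite
    of a value of K. *)
Lemma Rintegral_monotone_derivative (phi K k : R -> R) (a b eta : R) : a <= b ->
  {homo phi : x y / x <= y} -> (forall x, `|phi x| <= 1) ->
  (forall x : R, is_derive x 1 K (k x)) -> continuous k ->
  K a = 0 -> K b = 0 -> (forall x, a <= x <= b -> - eta <= K x) ->
  Rintegral mu `]a, b[ (fun x => phi x * k x) <= 2 * eta.
Proof.
move=> ab phi_nd phi1 dK ck Ka Kb Keta.
have mI : measurable (`]a, b[%classic : set R) by [].
have ik := @continuous_itv_integrable k a b ck.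
have ink : mu.-integrable `]a, b[ (EFin \o (fun x => `|k x|)).
  by apply: continuous_itv_integrable => x; apply: continuous_comp (ck x) (@norm_continuous _ R^o _).
have step (t : R) : let f x := (t < phi x)%R%:R * k x in
    mu.-integrable `]a, b[ (EFin \o f) /\ Rintegral mu `]a, b[ f <= eta.
  move=> f; split.
    apply: (@monotone_itv_integrable (fun x => (t < phi x)%R%:R)) => // [x y xy|x].
      rewrite ler_nat; case: (ltP t (phi x)) => // tx.
      by rewrite (lt_le_trans tx)// phi_nd.
    by rewrite normr_nat lern1 leq_b1.
  have -> : Rintegral mu `]a, b[ f =
      Rintegral mu (`]a, b[ `&` [set x | t < phi x]) k.
    rewrite Rintegral_mkcondr; apply: eq_Rintegral => x _.
    rewrite patchE /f; case: ifPn => [|] /=.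
      by rewrite inE /= => ->; rewrite mul1r.
    by rewrite notin_setE /= => /negP/negbTE ->; rewrite mul0r.
  have [s sab ->] : exists2 s, a <= s <= b &
      Rintegral mu (`]a, b[ `&` [set x | t < phi x]) k = K b - K s.
    apply: (Rintegral_derivative_upset dK ck ab); first by move=> x [].
    move=> x y [/= xab tx] xy yb.
    split => /=; last exact: lt_le_trans (phi_nd _ _ xy).
    move: xab; rewrite !in_itv/= yb andbT => /andP[ax _]; exact: lt_le_trans xy.
  by rewrite Kb sub0r lerNl Keta.
have steps (c : R) (t : nat -> R) (n : nat) : 0 <= c ->
    let f x := (\sum_(j < n) c * (t j < phi x)%R%:R) * k x in
    mu.-integrable `]a, b[ (EFin \o f) /\
    Rintegral mu `]a, b[ f <= n%:R * (c * eta).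
  move=> c0; elim: n => [|n [IH1 IH2]].
    have -> : (fun x => (\sum_(j < 0) c * (t j < phi x)%R%:R) * k x) = fun=> 0.
      by apply/funext => x; rewrite big_ord0 mul0r.
    split; first by have := integrable0 mu `]a, b[; apply: eq_integrable.
    by rewrite Rintegral_cst// !mul0r.
  have [sI sl] := step (t n).
  have E : (fun x => (\sum_(j < n.+1) c * (t j < phi x)%R%:R) * k x) =
      (fun x => (\sum_(j < n) c * (t j < phi x)%R%:R) * k x +
                c * ((t n < phi x)%R%:R * k x)).
    by apply/funext => x; rewrite big_ord_recr/= mulrDl mulrA.
  have icI : mu.-integrable `]a, b[
      (EFin \o (fun x => c * ((t n < phi x)%R%:R * k x))).
    exact: integrable_scale.
  rewrite /= E; split.
    exact: integrable_add.
  rewrite RintegralD// RintegralZl// -natr1 mulrDl mul1r.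
  by apply: lerD => //; exact: ler_wpM2l.
have intk : Rintegral mu `]a, b[ k = 0.
  by rewrite (@Rintegral_derivative_itv _ K)// Ka Kb subrr.
set C := Rintegral mu `]a, b[ (fun x => `|k x|).
have C0 : 0 <= C by apply: Rintegral_ge0.
have bound m : (0 < m)%N ->
    Rintegral mu `]a, b[ (fun x => phi x * k x) <= 2 * eta + 2 / m%:R * C.
  move=> m0; have m0' : 0 < m%:R :> R by rewrite ltr0n.
  have c0 : 0 <= 2 / m%:R :> R by rewrite divr_ge0// ltW.
  pose S x : R := \sum_(j < m) 2 / m%:R * (-1 + 2 / m%:R * j%:R < phi x)%R%:R.
  pose f x := S x * k x.
  have [/= fI fl] : mu.-integrable `]a, b[ (EFin \o f) /\
      Rintegral mu `]a, b[ f <= m%:R * (2 / m%:R * eta).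
    exact: (steps (2 / m%:R) (fun j => -1 + 2 / m%:R * j%:R) m c0).
  have i1 : mu.-integrable `]a, b[ (EFin \o (fun x => f x - k x)).
    exact: integrable_sub.
  have i2 : mu.-integrable `]a, b[ (EFin \o (fun x => 2 / m%:R * `|k x|)).
    exact: integrable_scale.
  apply: (@le_trans _ _ (Rintegral mu `]a, b[
      (fun x => (f x - k x) + 2 / m%:R * `|k x|))).
    apply: le_Rintegral => //.
    - exact: monotone_itv_integrable.
    - exact: integrable_add.
    - move=> x _; rewrite -lerBlDl.
      have -> : phi x * k x - (f x - k x) = (phi x - (S x - 1)) * k x.
        by rewrite /f; ring.
      apply: le_trans (ler_norm _) _; rewrite normrM ler_wpM2r//.
      by apply: layer_approx => //; rewrite -ler_norml.
  rewrite RintegralD// RintegralB// RintegralZl// intk subr0 lerD2r.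
  by apply: le_trans fl _; rewrite mulrA mulrCA divff ?mulr1// gt_eqF.
apply/ler_addgt0Pr => e e0.
have [m Hm] : exists m : nat, 2 * C / e < m%:R.
  by exists (Num.truncn (2 * C / e)).+1; exact: truncnS_gt.
have Ce : 0 <= 2 * C / e by rewrite divr_ge0 ?mulr_ge0// ltW.
have m0 : 0 < m%:R :> R by exact: le_lt_trans Hm.
apply: le_trans (bound m _) _; first by rewrite ltr0n in m0.
rewrite lerD2l mulrAC ler_pdivrMr// [leRHS]mulrC -ler_pdivrMr//; exact: ltW.
Qed.
End KeyLemma.

(** * Cosine coefficients of a monotone function *)

Section CosineCoefficients.
Variables (R : realType) (phi : R -> R).
Local Notation mu := (@lebesgue_measure R).
Hypothesis phi_nd : {homo phi : x y / x <= y}.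
Hypothesis phi1 : forall x, `|phi x| <= 1.

Definition cos_coef (n : nat) : R :=
  2 / pi * Rintegral mu `]0, pi[ (fun theta => phi theta * cos (n%:R * theta)).

Lemma is_derive_sin_nat (n : nat) (x : R) :
  is_derive x 1 (fun t : R => sin (n%:R * t)) (n%:R * cos (n%:R * x)).
Proof.
have -> : (fun t : R => sin (n%:R * t)) = sin \o (fun t => n%:R * t) by [].
by apply: is_derive_eq; rewrite /GRing.scale /= mulr1 mulrC.
Qed.

Lemma continuous_cos_nat (n : nat) : continuous (fun x : R => cos (n%:R * x)).
Proof.
move=> x; apply: continuous_comp; last exact: continuous_cos.
by apply: continuousM; [exact: cst_continuous|exact: cvg_id].
Qed.

Lemma sin_natMpi (n : nat) : sin (n%:R * pi) = 0 :> R.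
Proof.
elim: n => [|n IH]; first by rewrite mul0r sin0.
by rewrite -natr1 mulrDl mul1r sinDpi IH oppr0.
Qed.

(** By the addition formula, each step of the induction adds at most sin x. *)
Lemma normr_sin_nat (n : nat) (x : R) : 0 <= x <= pi ->
  `|sin (n%:R * x)| <= n%:R * sin x.
Proof.
move=> xpi; have s0 : 0 <= sin x.
  exact: sin_ge0_pi.
elim: n => [|n IH]; first by rewrite mul0r sin0 normr0 mul0r.
rewrite -natr1 !mulrDl !mul1r sinD.
apply: le_trans (ler_normD _ _) _; rewrite !normrM; apply: lerD.
  apply: le_trans IH; rewrite ler_piMr// ler_norml; apply/andP; split.
    exact: cos_geN1.
  exact: cos_le1.
rewrite (ger0_norm s0) ler_piMl// ler_norml cos_geN1 cos_le1//.
Qed.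

(** The derivative of a sine polynomial K pairs with phi to give the
    combination of coefficients, and K vanishes at both ends of [0, pi]. A lower
    bound on K is a lower bound on its Stieltjes integral against phi. *)
Lemma cos_coef_pairing (s : seq (R * nat)) (eta : R) :
  (forall x, 0 <= x <= pi -> - eta <= \sum_(p <- s) p.1 * sin (p.2%:R * x)) ->
  \sum_(p <- s) p.1 * (p.2%:R * cos_coef p.2) <= 4 / pi * eta.
Proof.
move=> Keta.
pose K x := \sum_(p <- s) p.1 * sin (p.2%:R * x) : R.
pose k x := \sum_(p <- s) p.1 * (p.2%:R * cos (p.2%:R * x)) : R.
have dK (x : R) : is_derive x 1 K (k x).
  rewrite /K /k; elim: (s) => [|p s' IH].
    rewrite big_nil (_ : (fun x => _) = cst 0); first exact: is_derive_cst.
    by apply/funext => y; rewrite big_nil.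
  rewrite big_cons (_ : (fun x => _) =
    (fun x => p.1 * sin (p.2%:R * x)) \+ (fun x => \sum_(p <- s') p.1 * sin (p.2%:R * x))).
    apply: is_deriveD; have := @is_deriveZ _ _ _ _ p.1 x 1 _ (is_derive_sin_nat p.2 x).
    by [].
  by apply/funext => y; rewrite big_cons.
have ck : continuous k.
  rewrite /k; elim: (s) => [|p s' IH].
    rewrite (_ : (fun x => _) = cst 0); first exact: cst_continuous.
    by apply/funext => y; rewrite big_nil.
  rewrite (_ : (fun x => _) = (fun x => p.1 * (p.2%:R * cos (p.2%:R * x))) \+
    (fun x => \sum_(p <- s') p.1 * (p.2%:R * cos (p.2%:R * x)))); last first.
    by apply/funext => y; rewrite big_cons.
  move=> x; apply: continuousD; last exact: IH.
  apply: continuousM; first exact: cst_continuous.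
  apply: continuousM; first exact: cst_continuous.
  exact: continuous_cos_nat.
have := @Rintegral_monotone_derivative R phi K k 0 pi eta (pi_ge0 R) phi_nd phi1 dK ck.
have -> : K 0 = 0 by rewrite /K big1// => p _; rewrite mulr0 sin0 mulr0.
have -> : K pi = 0 by rewrite /K big1// => p _; rewrite sin_natMpi mulr0.
move=> /(_ erefl erefl Keta) Hle.
have mI : measurable (`]0, pi[%classic : set R) by [].
have icos (n : nat) : mu.-integrable `]0, pi[
    (EFin \o (fun x => phi x * cos (n%:R * x))).
  by apply: monotone_itv_integrable => //; exact: continuous_cos_nat.
have [_ E] : mu.-integrable `]0, pi[ (EFin \o (fun x => phi x * k x)) /\
    Rintegral mu `]0, pi[ (fun x => phi x * k x) =
    \sum_(p <- s) p.1 * (p.2%:R * (pi / 2 * cos_coef p.2)).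
  rewrite /k; elim: (s) => [|p s' [IH1 IH2]].
    have -> : (fun x => phi x * \sum_(p <- [::]) p.1 * (p.2%:R * cos (p.2%:R * x)))
       = fun=> 0 by apply/funext => x; rewrite big_nil mulr0.
    rewrite big_nil; split; first by have := integrable0 mu `]0, pi[; apply: eq_integrable.
    by rewrite Rintegral_cst// !mul0r.
  have -> : (fun x => phi x * \sum_(p <- p :: s') p.1 * (p.2%:R * cos (p.2%:R * x)))
     = fun x => (p.1 * p.2%:R) * (phi x * cos (p.2%:R * x)) +
          phi x * \sum_(p <- s') p.1 * (p.2%:R * cos (p.2%:R * x)).
    by apply/funext => x; rewrite big_cons; ring.
  have i1 : mu.-integrable `]0, pi[
      (EFin \o (fun x => (p.1 * p.2%:R) * (phi x * cos (p.2%:R * x)))).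
    apply: integrable_scale => //; exact: icos.
  split; first exact: integrable_add.
  rewrite RintegralD// RintegralZl// big_cons IH2; congr (_ + _).
  rewrite /cos_coef; have pi0 := pi_gt0 R; field; lra.
have pi0 := pi_gt0 R.
rewrite E in Hle.
have -> : \sum_(p <- s) p.1 * (p.2%:R * cos_coef p.2) =
   2 / pi * \sum_(p <- s) p.1 * (p.2%:R * (pi / 2 * cos_coef p.2)).
  rewrite mulr_sumr; apply: eq_bigr => p _; field; lra.
have -> : 4 / pi * eta = 2 / pi * (2 * eta) by field; lra.
by rewrite ler_wpM2l// divr_ge0// ltW.
Qed.

(** The sine polynomials n sin x + sin (n x) and n sin x - sin (n x) are
    nonnegative on [0, pi]. *)
Lemma cos_coef_dominated (n : nat) : (0 < n)%N -> `|cos_coef n| <= - cos_coef 1.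
Proof.
move=> n0; have n0' : 0 < n%:R :> R by rewrite ltr0n.
have H1 := @cos_coef_pairing [:: (n%:R, 1%N); (1, n)] 0.
have H2 := @cos_coef_pairing [:: (n%:R, 1%N); (-1, n)] 0.
rewrite !(big_cons, big_nil)/= in H1 H2.
have K1 : n%:R * (1 * cos_coef 1) + (1 * (n%:R * cos_coef n) + 0) <= 4 / pi * 0.
  apply: H1 => x xpi; rewrite !(big_cons, big_nil)/= !mul1r addr0 oppr0.
  have := normr_sin_nat n xpi; rewrite ler_norml; lra.
have K2 : n%:R * (1 * cos_coef 1) + (-1 * (n%:R * cos_coef n) + 0) <= 4 / pi * 0.
  apply: H2 => x xpi; rewrite !(big_cons, big_nil)/= !mul1r addr0 oppr0.
  have := normr_sin_nat n xpi; rewrite ler_norml; lra.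
rewrite ler_norml; apply/andP; split; nra.
Qed.

(** Here the sine polynomials are sin (n x) and - sin (n x), bounded below
    by -1. *)
Lemma cos_coef_decay (n : nat) : n%:R * `|cos_coef n| <= 2.
Proof.
have H1 := @cos_coef_pairing [:: (1, n)] 1.
have H2 := @cos_coef_pairing [:: (-1, n)] 1.
rewrite !(big_cons, big_nil)/= in H1 H2.
have p2 : 4 / pi <= 2 :> R.
  rewrite ler_pdivrMr ?pi_gt0//; have := pi_ge2 R; lra.
have K1 : 1 * (n%:R * cos_coef n) + 0 <= 4 / pi * 1.
  apply: H1 => x xpi; rewrite !(big_cons, big_nil)/=.
  have := sin_geN1 (n%:R * x); lra.
have K2 : -1 * (n%:R * cos_coef n) + 0 <= 4 / pi * 1.
  apply: H2 => x xpi; rewrite !(big_cons, big_nil)/=.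
  have := sin_le1 (n%:R * x); lra.
have -> : n%:R * `|cos_coef n| = `|n%:R * cos_coef n| by rewrite [RHS]normrM normr_nat.
by rewrite ler_norml; apply/andP; split; lra.
Qed.

End CosineCoefficients.

(** * Coordinates and modulus of complex numbers *)

Section ComplexParts.
Variable (R : realType).
Local Notation Re := (@complex.Re R).
Local Notation Im := (@complex.Im R).
Implicit Types z w : R[i].

Lemma ReM z w : Re (z * w) = Re z * Re w - Im z * Im w. Proof. by case: z w => [a b] [c d]. Qed.
Lemma ImM z w : Im (z * w) = Re z * Im w + Im z * Re w. Proof. by case: z w => [a b] [c d]. Qed.
Lemma ReD z w : Re (z + w) = Re z + Re w. Proof. by case: z w => [a b] [c d]. Qed.
Lemma ImD z w : Im (z + w) = Im z + Im w. Proof. by case: z w => [a b] [c d]. Qed.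
Lemma ReN z : Re (- z) = - Re z. Proof. by case: z => [a b]. Qed.
Lemma ImN z : Im (- z) = - Im z. Proof. by case: z => [a b]. Qed.
Lemma ReB z w : Re (z - w) = Re z - Re w. Proof. by rewrite ReD ReN. Qed.
Lemma ImB z w : Im (z - w) = Im z - Im w. Proof. by rewrite ImD ImN. Qed.
Lemma ReJ z : Re (conjc z) = Re z. Proof. by case: z => [a b]. Qed.
Lemma ImJ z : Im (conjc z) = - Im z. Proof. by case: z => [a b]. Qed.
Definition Re_Im_E := (ReM, ImM, ReB, ImB, ReD, ImD, ReN, ImN, ReJ, ImJ).

Lemma Re_realM (x : R) z : Re (x%:C * z) = x * Re z.
Proof. by rewrite ReM /= mul0r subr0. Qed.
Lemma Im_realM (x : R) z : Im (x%:C * z) = x * Im z.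
Proof. by rewrite ImM /= mul0r addr0. Qed.

Lemma Re_sum (I : Type) (r : seq I) (P : pred I) (F : I -> R[i]) :
  Re (\sum_(i <- r | P i) F i) = \sum_(i <- r | P i) Re (F i).
Proof. by apply: (big_morph Re) => // z w; exact: ReD. Qed.

Lemma normc_sq z : normc z ^+ 2 = Re z ^+ 2 + Im z ^+ 2.
Proof. by case: z => a b /=; rewrite sqr_sqrtr// addr_ge0// sqr_ge0. Qed.
Lemma normc_ge0 z : 0 <= normc z.
Proof. by case: z => a b /=; exact: sqrtr_ge0. Qed.
Lemma normcD z w : normc (z + w) <= normc z + normc w.
Proof. exact: le_normcD. Qed.
Lemma normcM z w : normc (z * w) = normc z * normc w.
Proof. exact: ComplexField.Normc.normcM. Qed.
Lemma normc_opp z : normc (- z) = normc z.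
Proof. exact: normcN. Qed.
Lemma normcB z w : normc (z - w) <= normc z + normc w.
Proof. by rewrite -(normc_opp w); exact: normcD. Qed.
Lemma normcX z n : normc (z ^+ n) = normc z ^+ n.
Proof.
elim: n => [|n IH]; first by rewrite !expr0; exact: ComplexField.Normc.normc1.
by rewrite !exprS normcM IH.
Qed.
Lemma normc_real (x : R) : normc x%:C = `|x|.
Proof. by rewrite /= expr0n/= addr0 sqrtr_sqr. Qed.
Lemma ler_Re_normc z : `|Re z| <= normc z.
Proof.
rewrite -(@ler_pXn2r _ 2%N)// ?nnegrE ?normr_ge0 ?normc_ge0//.
by rewrite normc_sq real_normK ?num_real// lerDl sqr_ge0.
Qed.
Lemma ler_Im_normc z : `|Im z| <= normc z.
Proof.
rewrite -(@ler_pXn2r _ 2%N)// ?nnegrE ?normr_ge0 ?normc_ge0//.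
by rewrite normc_sq real_normK ?num_real// lerDr sqr_ge0.
Qed.
Lemma normc_eq0 z : (normc z == 0) = (z == 0).
Proof.
apply/eqP/eqP => [/ComplexField.Normc.eq0_normc//|->]; exact: ComplexField.Normc.normc0.
Qed.
Lemma normc_conj z : normc (conjc z) = normc z.
Proof. by case: z => a b /=; rewrite sqrrN. Qed.

(** * The sine kernel *)

Lemma sin_three_term (n : nat) (x : R) :
  sin (n.+2%:R * x) = 2 * cos x * sin (n.+1%:R * x) - sin (n%:R * x).
Proof.
have -> : n.+2%:R * x = n.+1%:R * x + x by rewrite -[n.+2%:R]natr1; ring.
have -> : n%:R * x = n.+1%:R * x - x by rewrite -[n.+1%:R]natr1; ring.
rewrite sinD sinB; ring.
Qed.

(** The generating function of sin ((n + 1) x) is sin x / (1 - 2 z cos x + z^2);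
    the identity for partial sums keeps the error term explicit. *)
Lemma sum_sin_geometric (N : nat) (x : R) z :
  (1 - 2 * (cos x)%:C * z + z ^+ 2) *
    \sum_(n < N) (sin (n.+1%:R * x))%:C * z ^+ n =
  (sin x)%:C - z ^+ N * (sin (N.+1%:R * x))%:C + z ^+ N.+1 * (sin (N%:R * x))%:C.
Proof.
elim: N => [|N IH].
  by rewrite big_ord0 mulr0 expr0 mul0r sin0 !mul1r mulr0 addr0 subrr.
rewrite big_ord_recr/= mulrDr IH sin_three_term.
rewrite rmorphB/= !rmorphM/= rmorph_nat !exprS; ring.
Qed.

(** Positivity of the kernel (1 - z^2) / (1 - 2 z cos x + z^2): up to a
    positive factor, its real part is the right-hand side. *)
Lemma Re_one_sub_sq_conj (x : R) z :
  Re ((1 - z ^+ 2) * conjc (1 - 2 * (cos x)%:C * z + z ^+ 2)) =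
  (1 - normc z ^+ 2) * (1 + normc z ^+ 2 - 2 * cos x * Re z).
Proof.
rewrite normc_sq; case: z => a b; rewrite !Re_Im_E/=.
rewrite ?expr2 ?Re_Im_E /=; ring.
Qed.

End ComplexParts.

Section Kernel.
Variable (R : realType).
Local Notation Re := (@complex.Re R).
Local Notation Im := (@complex.Im R).
Implicit Types z w : R[i].

(** A lower bound, on the disc of radius rho, for the right-hand side of
    [Re_one_sub_sq_conj]. *)
Definition margin (rho : R) : R := (1 - rho ^+ 2) * (1 - rho) ^+ 2.

Lemma margin_gt0 (rho : R) : 0 <= rho < 1 -> 0 < margin rho.
Proof. by move=> /andP[r0 r1]; rewrite mulr_gt0 ?exprn_gt0; nra. Qed.

Lemma mul_conjc z : z * conjc z = (normc z ^+ 2)%:C.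
Proof.
rewrite normc_sq; case: z => a b; apply/eqP; rewrite eq_complex/=.
by apply/andP; split; apply/eqP; ring.
Qed.

(** The full series has real part at least margin / 16 times sin x, since the
    denominator has modulus at most 4; it has modulus at least margin / 2, which
    controls the remainder of the partial sum. *)
Lemma sine_kernel_ge (rho : R) z (N : nat) (x : R) :
  0 <= rho < 1 -> normc z <= rho -> 0 <= x <= pi ->
  margin rho / 16 * sin x - 8 * rho ^+ N / margin rho <=
  \sum_(n < N) Re ((1 - z ^+ 2) * z ^+ n) * sin (n.+1%:R * x).
Proof.
move=> rho01 zrho xpi; have m0 := margin_gt0 rho01.
have s0 : 0 <= sin x by exact: sin_ge0_pi.
set m := margin rho in m0 *.
set A := 1 - z ^+ 2; set D := 1 - 2 * (cos x)%:C * z + z ^+ 2.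
set S := \sum_(n < N) (sin (n.+1%:R * x))%:C * z ^+ n.
set E := z ^+ N.+1 * (sin (N%:R * x))%:C - z ^+ N * (sin (N.+1%:R * x))%:C.
have z0 := normc_ge0 z.
have n1 : normc (1 : R[i]) = 1 by exact: ComplexField.Normc.normc1.
have DS : D * S = (sin x)%:C + E by rewrite sum_sin_geometric /E; ring.
have -> : \sum_(n < N) Re (A * z ^+ n) * sin (n.+1%:R * x) = Re (A * S).
  rewrite /S mulr_sumr Re_sum; apply: eq_bigr => n _.
  by rewrite mulrCA Re_realM mulrC.
have ADm : m <= Re (A * conjc D).
  rewrite Re_one_sub_sq_conj; apply: ler_pM.
  - by move: rho01 => /andP[? ?]; nra.
  - exact: sqr_ge0.
  - by move: rho01 => /andP[? ?]; nra.
  - have ca : cos x * Re z <= normc z.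
      apply: le_trans (ler_norm _) _; rewrite normrM.
      apply: le_trans (ler_Re_normc z); rewrite ler_piMl// ler_norml.
      by rewrite cos_geN1 cos_le1.
    by move: rho01 => /andP[? ?]; nra.
have An : normc A <= 2.
  apply: le_trans (normcB _ _) _; rewrite normcX n1.
  by move: rho01 => /andP[? ?]; nra.
have Dn : normc D <= 4.
  have c1 : `|cos x| <= 1 by rewrite ler_norml cos_geN1 cos_le1.
  have two : normc (2 : R[i]) = 2.
    have -> : (2 : R[i]) = 2%:C by rewrite rmorph_nat.
    by rewrite normc_real ger0_norm.
  apply: le_trans (normcD _ _) _; rewrite normcX.
  have := normcB 1 (2 * (cos x)%:C * z); rewrite n1 !normcM two normc_real.
  have : `|cos x| * normc z <= 1 by rewrite mulr_ile1//; move: rho01 => /andP[? ?]; lra.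
  by move: rho01 => /andP[? ?]; nra.
have En : normc E <= 2 * rho ^+ N.
  have rN : 0 <= rho ^+ N by rewrite exprn_ge0//; move: rho01 => /andP[].
  have zN : normc z ^+ N <= rho ^+ N.
    by apply: lerXn2r; rewrite ?nnegrE//; move: rho01 => /andP[].
  have zNS : normc z ^+ N.+1 <= rho ^+ N.
    rewrite exprS; apply: le_trans zN; rewrite ler_piMl ?exprn_ge0//.
    by move: rho01 => /andP[? ?]; lra.
  have sb (y : R) : `|sin y| <= 1 by rewrite ler_norml sin_geN1 sin_le1.
  apply: le_trans (normcB _ _) _; rewrite !normcM !normc_real !normcX.
  have := ler_pM (exprn_ge0 N.+1 z0) (normr_ge0 (sin (N%:R * x))) zNS (sb _).
  have := ler_pM (exprn_ge0 N z0) (normr_ge0 (sin (N.+1%:R * x))) zN (sb _).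
  lra.
set d := normc D in Dn; set q := Re (A * S).
have d0 : m / 2 <= d.
  have : Re (A * conjc D) <= normc A * d.
    rewrite /d -(normc_conj D) -normcM; exact: (le_trans (ler_norm _) (ler_Re_normc _)).
  have := normc_ge0 A; have := normc_ge0 D; rewrite -/d; nra.
have qd : q * d ^+ 2 = Re (A * conjc D) * sin x + Re (A * conjc D * E).
  have : A * S * (D * conjc D) = A * conjc D * ((sin x)%:C + E).
    by rewrite -DS; ring.
  rewrite mul_conjc -/d => /(congr1 Re).
  by rewrite mulrC Re_realM mulrDr ReD [A * _ * _%:C]mulrC Re_realM -/q => H; rewrite mulrC H mulrC.
have AE : - (4 * d * rho ^+ N) <= Re (A * conjc D * E).
  have := ler_Re_normc (A * conjc D * E); rewrite !normcM normc_conj -/d ler_norml => /andP[H _].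
  apply: le_trans H; rewrite lerN2.
  have dd : 0 <= d by lra.
  have a0 := normc_ge0 A; have e0 := normc_ge0 E.
  have : normc A * d <= 2 * d by rewrite ler_wpM2r.
  have : 0 <= normc A * d by exact: mulr_ge0.
  by move=> h1 h2; have := ler_pM h1 e0 h2 En; lra.
have dpos : 0 < d by lra.
have rN : 0 <= rho ^+ N by rewrite exprn_ge0//; move: rho01 => /andP[].
rewrite -(@ler_pM2r _ (d ^+ 2)) ?exprn_gt0// qd mulrBl.
apply: lerD.
  rewrite mulrAC; apply: ler_wpM2r => //; apply: le_trans ADm.
  have : d ^+ 2 <= 16 by nra.
  by nra.
apply: le_trans AE; rewrite lerN2.
have -> : 8 * rho ^+ N / m * d ^+ 2 = 4 * d * rho ^+ N * (2 * d / m).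
  by field; lra.
have h : 1 <= 2 * d / m by rewrite ler_pdivlMr//; lra.
by rewrite ler_peMr// !mulr_ge0// ltW.
Qed.

Variable phi : R -> R.
Hypothesis phi_nd : {homo phi : x y / x <= y}.
Hypothesis phi1 : forall x, `|phi x| <= 1.
Local Notation a := (cos_coef phi).

(** This is the pairing inequality for the sine polynomial of
    [sine_kernel_ge] minus margin / 16 times sin x, which is nonnegative up to
    the remainder. The term in a 1 is negative unless all coefficients
    vanish. *)
Lemma Re_derivative_le (rho : R) z (N : nat) : 0 <= rho < 1 -> normc z <= rho ->
  Re ((1 - z ^+ 2) * \sum_(n < N) (n.+1%:R * a n.+1)%:C * z ^+ n) <=
  margin rho / 16 * a 1%N + 16 * rho ^+ N / margin rho.
Proof.
move=> rho01 zrho; have m0 := margin_gt0 rho01.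
pose s := (- (margin rho / 16), 1%N) ::
  [seq (Re ((1 - z ^+ 2) * z ^+ n), n.+1) | n <- index_iota 0 N].
have := @cos_coef_pairing R phi phi_nd phi1 s (8 * rho ^+ N / margin rho).
rewrite /s big_cons big_map /= big_mkord.
have H x : 0 <= x <= pi -> - (8 * rho ^+ N / margin rho) <=
   \sum_(p <- s) p.1 * sin (p.2%:R * x).
  move=> xpi; rewrite /s big_cons big_map/= big_mkord mul1r.
  have := @sine_kernel_ge rho z N x rho01 zrho xpi; lra.
move=> /(_ H); rewrite mul1r.
have -> : Re ((1 - z ^+ 2) * \sum_(n < N) (n.+1%:R * a n.+1)%:C * z ^+ n) =
  \sum_(n < N) Re ((1 - z ^+ 2) * z ^+ n) * (n.+1%:R * a n.+1).
  rewrite mulr_sumr Re_sum; apply: eq_bigr => n _.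
  by rewrite mulrCA Re_realM mulrC.
have p2 : 4 / pi <= 2 :> R.
  rewrite ler_pdivrMr ?pi_gt0//; have := pi_ge2 R; lra.
have e0 : 0 <= 8 * rho ^+ N / margin rho.
  apply: divr_ge0; last exact: ltW.
  by apply: mulr_ge0 => //; apply: exprn_ge0; move: rho01 => /andP[].
have := ler_wpM2r e0 p2; lra.
Qed.
End Kernel.

(** * Velocities of paths in the plane *)

Section ComplexPath.
Variable (R : realType).
Local Notation Re := (@complex.Re R).
Local Notation Im := (@complex.Im R).
Implicit Types (z w e : R[i]) (f g : R -> R[i]) (t : R).

Lemma is_derive_add (u v : R -> R) t (du dv : R) :
  is_derive t 1 u du -> is_derive t 1 v dv ->
  is_derive t 1 (fun s => u s + v s) (du + dv).
Proof. exact: is_deriveD. Qed.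

Lemma is_derive_sub (u v : R -> R) t (du dv : R) :
  is_derive t 1 u du -> is_derive t 1 v dv ->
  is_derive t 1 (fun s => u s - v s) (du - dv).
Proof. exact: is_deriveB. Qed.

Lemma is_derive_mul (u v : R -> R) t (du dv : R) :
  is_derive t 1 u du -> is_derive t 1 v dv ->
  is_derive t 1 (fun s => u s * v s) (du * v t + u t * dv).
Proof.
move=> hu hv; have := is_deriveM hu hv; rewrite /GRing.scale/= => h.
by apply: is_derive_eq; rewrite addrC mulrC.
Qed.

(** The plane R[i] is normed over itself and not over R, so the derivative
    in a real parameter is taken on each coordinate. *)
Definition has_velocity f t (d : R[i]) :=
  is_derive t 1 (fun s => Re (f s)) (Re d) /\
  is_derive t 1 (fun s => Im (f s)) (Im d).

Lemma velocity_eq f t d d' : has_velocity f t d -> d = d' -> has_velocity f t d'.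
Proof. by move=> + <-. Qed.

Lemma velocity_cst z t : has_velocity (fun=> z) t 0.
Proof. by split; exact: is_derive_cst. Qed.

Lemma velocityD f g t df dg : has_velocity f t df -> has_velocity g t dg ->
  has_velocity (fun s => f s + g s) t (df + dg).
Proof.
move=> [fr fi] [gr gi]; split; rewrite Re_Im_E.
  under eq_fun do rewrite ReD; exact: is_derive_add.
under eq_fun do rewrite ImD; exact: is_derive_add.
Qed.

Lemma velocityM f g t df dg : has_velocity f t df -> has_velocity g t dg ->
  has_velocity (fun s => f s * g s) t (df * g t + f t * dg).
Proof.
move=> [fr fi] [gr gi]; split.
  under eq_fun do rewrite ReM.
  have h := is_derive_sub (is_derive_mul fr gr) (is_derive_mul fi gi).
  by apply: is_derive_eq; rewrite !Re_Im_E; ring.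
under eq_fun do rewrite ImM.
have h := is_derive_add (is_derive_mul fr gi) (is_derive_mul fi gr).
by apply: is_derive_eq; rewrite !Re_Im_E; ring.
Qed.

Lemma Re_inv z : Re z^-1 = Re z / normc z ^+ 2.
Proof. by rewrite normc_sq; case: z. Qed.
Lemma Im_inv z : Im z^-1 = - (Im z / normc z ^+ 2).
Proof. by rewrite normc_sq; case: z. Qed.

Lemma velocityV f t df : f t != 0 -> has_velocity f t df ->
  has_velocity (fun s => (f s)^-1) t (- df / f t ^+ 2).
Proof.
move=> ft [fr fi].
have n0 : Re (f t) ^+ 2 + Im (f t) ^+ 2 != 0.
  by rewrite -normc_sq sqrf_eq0 normc_eq0.
have hn : is_derive t 1 (fun s => Re (f s) ^+ 2 + Im (f s) ^+ 2)
    (2 * (Re (f t) * Re df + Im (f t) * Im df)).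
  under eq_fun do rewrite !expr2.
  have h := is_derive_add (is_derive_mul fr fr) (is_derive_mul fi fi).
  by apply: is_derive_eq; ring.
have hv := @is_deriveV R (fun s => Re (f s) ^+ 2 + Im (f s) ^+ 2) t _ 1 n0 hn; rewrite /GRing.scale/= in hv.
have E : - df / f t ^+ 2 = - (df * conjc (f t) ^+ 2) * ((Re (f t) ^+ 2 + Im (f t) ^+ 2) ^- 2)%:C.
  rewrite -normc_sq.
  have H : conjc (f t) ^+ 2 * ((normc (f t) ^+ 2) ^- 2)%:C = (f t ^+ 2)^-1.
    rewrite fmorphV rmorphXn/= -mul_conjc exprMn invfM mulrCA mulfV ?mulr1//.
    by rewrite expf_eq0/= conjc_eq0.
  by rewrite !mulNr -mulrA H.
rewrite E; split.
  under eq_fun do rewrite Re_inv normc_sq.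
  have h := is_derive_mul fr hv.
  apply: is_derive_eq; rewrite [in RHS]mulrC Re_realM ?expr2 !Re_Im_E; field.
  by rewrite -?expr2.
have -> : (fun s => Im (f s)^-1) = (fun s => - (Im (f s) * (Re (f s) ^+ 2 + Im (f s) ^+ 2)^-1)).
  by apply/funext => s; rewrite Im_inv normc_sq.
have h := is_deriveN (is_derive_mul fi hv).
apply: is_derive_eq; rewrite [in RHS]mulrC Im_realM ?expr2 !Re_Im_E; field.
by rewrite -?expr2.
Qed.

Lemma velocityX f t df n : has_velocity f t df ->
  has_velocity (fun s => f s ^+ n) t (n%:R * f t ^+ n.-1 * df).
Proof.
move=> hf; elim: n => [|n IH].
  by rewrite mul0r mul0r; exact: velocity_cst.
under eq_fun do rewrite exprS.
apply: velocity_eq (velocityM hf IH) _.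
case: n {IH} => [|n]; first by rewrite expr0 !mulr1 !mul0r mulr0 addr0 mul1r.
by rewrite exprS/= -[n.+2%:R]natr1 ; ring.
Qed.

Lemma velocity_sum (F : nat -> R -> R[i]) (d : nat -> R[i]) t N :
  (forall n, has_velocity (F n) t (d n)) ->
  has_velocity (fun s => \sum_(n < N) F n s) t (\sum_(n < N) d n).
Proof.
move=> H; elim: N => [|N IH].
  under eq_fun do rewrite big_ord0; rewrite big_ord0; exact: velocity_cst.
under eq_fun do rewrite big_ord_recr/=.
rewrite big_ord_recr/=; exact: velocityD.
Qed.
End ComplexPath.

(** * The strip model of the unit disc *)

Section Strip.
Variable (R : realType).
Local Notation Re := (@complex.Re R).
Local Notation Im := (@complex.Im R).
Implicit Types (z w e : R[i]) (x y t : R).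

Definition cexp x y : R[i] := (expR x * cos y) +i* (expR x * sin y).

(** This is (w - 1) / (w + 1) at w = exp (x + i y): the inverse of
    log ((1 + z) / (1 - z)), which maps the disc onto the strip where
    |y| < pi / 2. *)
Definition strip_map x y : R[i] := 1 - 2 / (cexp x y + 1).

Lemma cexp_velocity x y dx dy t :
  has_velocity (fun s => cexp (x + s * dx) (y + s * dy)) t
    ((dx +i* dy) * cexp (x + t * dx) (y + t * dy)).
Proof.
have lin (u v : R) : is_derive t 1 (fun s => u + s * v) v.
  have h := is_derive_add (is_derive_cst u t 1) (is_derive_mul (is_derive_id t 1) (is_derive_cst v t 1)).
  by apply: is_derive_eq; rewrite add0r mul1r mulr0 addr0.
have he := @is_derive1_comp _ expR (fun s => x + s * dx) t _ _ (is_derive_expR (x + t * dx)) (lin x dx).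
have hc := @is_derive1_comp _ cos (fun s => y + s * dy) t _ _ (is_derive_cos (y + t * dy)) (lin y dy).
have hs := @is_derive1_comp _ sin (fun s => y + s * dy) t _ _ (is_derive_sin (y + t * dy)) (lin y dy).
split.
  have h := is_derive_mul he hc.
  by apply: is_derive_eq; rewrite /=; ring.
have h := is_derive_mul he hs.
by apply: is_derive_eq; rewrite /=; ring.
Qed.

Lemma Re_cexp_gt0 x y : - (pi / 2) < y < pi / 2 -> 0 < Re (cexp x y).
Proof. by move=> hy; rewrite mulr_gt0 ?expR_gt0// cos_gt0_pihalf. Qed.

Lemma cexp1_neq0 x y : - (pi / 2) < y < pi / 2 -> cexp x y + 1 != 0.
Proof.
move=> hy; apply/eqP => /(congr1 Re); rewrite ReD /=.
have := Re_cexp_gt0 x hy; rewrite /=; lra.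
Qed.

(** On the strip, the derivative in the coordinate x + i y is multiplication by
    (1 - z^2) / 2; this is what makes the sign of Re ((1 - z^2) psi'(z))
    usable along segments of the strip. *)
Lemma strip_map_velocity x y dx dy t : - (pi / 2) < y + t * dy < pi / 2 ->
  has_velocity (fun s => strip_map (x + s * dx) (y + s * dy)) t
    ((dx +i* dy) * (1 - strip_map (x + t * dx) (y + t * dy) ^+ 2) / 2).
Proof.
move=> hy; rewrite /strip_map.
have w0 := cexp1_neq0 (x + t * dx) hy.
have h1 := velocityD (cexp_velocity x y dx dy t) (velocity_cst 1 t).
have h2 := velocityM (velocity_cst (-2) t) (velocityV w0 h1).
have h3 := velocityD (velocity_cst 1 t) h2.
have -> : (fun s => 1 - 2 / (cexp (x + s * dx) (y + s * dy) + 1)) =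
  (fun s => 1 + (- 2) * (cexp (x + s * dx) (y + s * dy) + 1)^-1).
  by apply/funext => s; rewrite mulNr.
apply: velocity_eq h3 _; field.
by [].
Qed.

Lemma normc_strip_map x y : - (pi / 2) < y < pi / 2 ->
  normc (strip_map x y) ^+ 2 = 1 - 4 * (expR x * cos y) / normc (cexp x y + 1) ^+ 2.
Proof.
move=> hy; have w0 := cexp1_neq0 x hy.
have n0 : normc (cexp x y + 1) != 0 by rewrite normc_eq0.
have -> : strip_map x y = (cexp x y - 1) / (cexp x y + 1) by rewrite /strip_map; field.
rewrite normcM ComplexField.Normc.normcV exprMn exprVn.
apply: (@mulIf _ (normc (cexp x y + 1) ^+ 2)); first by rewrite sqrf_eq0.
rewrite mulfVK ?sqrf_eq0// mulrBl mul1r mulfVK ?sqrf_eq0//.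
rewrite !normc_sq !Re_Im_E /=; ring.
Qed.

(** The defect 1 - |z|^2 is 4 Re w / |w + 1|^2 at w = exp (x + i y), and each
    factor is controlled on a rectangle. *)
Lemma normc_strip_map_le (X Y : R) : 0 <= X -> 0 <= Y < pi / 2 ->
  exists2 rho, 0 <= rho < 1 &
    forall x y, - X <= x <= X -> - Y <= y <= Y -> normc (strip_map x y) <= rho.
Proof.
move=> X0 /andP[Y0 Ypi].
have cY : 0 < cos Y by rewrite cos_gt0_pihalf// Ypi andbT; have := pi_gt0 R; lra.
have cY1 := cos_le1 Y.
pose m := expR (- X) * cos Y.
have m0 : 0 < m by rewrite mulr_gt0 ?expR_gt0.
have eX : 1 <= expR X by rewrite -expR0 ler_expR.
have m1 : m <= 1.
  have : expR (- X) <= 1 by rewrite -expR0 ler_expR; lra.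
  by have := expR_gt0 (- X); rewrite /m; nra.
pose q := (expR X + 1) ^+ 2.
have q0 : 4 <= q by rewrite /q; nra.
have tq : 4 * m / q <= 1 by rewrite ler_pdivrMr; lra.
have t0 : 0 < 4 * m / q by rewrite divr_gt0; lra.
exists (1 - 2 * m / q).
  have -> : 2 * m / q = (4 * m / q) / 2 by field; lra.
  by apply/andP; split; lra.
move=> x y /andP[x1 x2] /andP[y1 y2].
have hy : - (pi / 2) < y < pi / 2 by apply/andP; split; lra.
rewrite -(@ler_pXn2r _ 2)// ?nnegrE ?normc_ge0//; last first.
  have -> : 2 * m / q = (4 * m / q) / 2 by field; lra.
  lra.
rewrite normc_strip_map//.
have w0 := cexp1_neq0 x hy.
have nw : 0 < normc (cexp x y + 1).
  by rewrite lt_neqAle eq_sym normc_eq0 w0 normc_ge0.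
have nc : normc (cexp x y) = expR x.
  rewrite /= (_ : _ + _ = expR x ^+ 2) ?sqrtr_sqr ?gtr0_norm ?expR_gt0//.
  by rewrite !exprMn -mulrDr cos2Dsin2 mulr1.
have n1 : normc (1 : R[i]) = 1 by exact: ComplexField.Normc.normc1.
have nq : normc (cexp x y + 1) ^+ 2 <= q.
  rewrite /q; apply: lerXn2r; rewrite ?nnegrE ?normc_ge0 ?addr_ge0 ?expR_ge0//.
  by apply: le_trans (normcD _ _) _; rewrite nc n1 lerD2r ler_expR.
have cyY : cos Y <= cos y.
  have yY : `|y| <= Y by rewrite ler_norml y1.
  have p0 := pi_gt0 R.
  rewrite -(cos_norm y) leNgt ltr_cos ?in_itv/= ?normr_ge0 ?Y0/= ?yY -?leNgt//; lra.
have mm : m <= expR x * cos y.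
  by apply: ler_pM => //; rewrite ?expR_ge0 ?ler_expR// ltW.
have le1 : 4 * m / q <= 4 * (expR x * cos y) / normc (cexp x y + 1) ^+ 2.
  apply: ler_pM; rewrite ?invr_ge0; try lra.
  by rewrite lef_pV2// posrE ?exprn_gt0//; lra.
have -> : 2 * m / q = (4 * m / q) / 2 by field; lra.
have : 0 <= (4 * m / q / 2) ^+ 2 by exact: sqr_ge0.
nra.
Qed.

(** The point w = (1 + z) / (1 - z) lies in the right half-plane, where polar
    coordinates are given by ln and asin. *)
Lemma strip_map_surj z : normc z < 1 ->
  exists x y, - (pi / 2) < y < pi / 2 /\ z = strip_map x y.
Proof.
move=> z1; pose w := (1 + z) / (1 - z).
have z1' : 1 - z != 0.
  rewrite subr_eq0; apply/eqP => E; move: z1; rewrite -E.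
  by rewrite ComplexField.Normc.normc1 ltxx.
have n1z : 0 < normc (1 - z) by rewrite lt_neqAle eq_sym normc_eq0 z1' normc_ge0.
have Rw : 0 < Re w.
  have E : Re w * normc (1 - z) ^+ 2 = 1 - normc z ^+ 2.
    rewrite mulrC -Re_realM -mul_conjc.
    have -> : (1 - z) * conjc (1 - z) * w = conjc (1 - z) * (1 + z) by rewrite /w; field.
    by rewrite normc_sq !Re_Im_E/=; ring.
  have : 0 < Re w * normc (1 - z) ^+ 2.
    by rewrite E subr_gt0 expr_lt1// normc_ge0.
  by rewrite pmulr_lgt0// exprn_gt0.
have nw : 0 < normc w.
  by apply: lt_le_trans Rw _; exact: le_trans (ler_norm _) (ler_Re_normc _).
have nsq := normc_sq w.
pose u := Im w / normc w.
have u2 : 1 - u ^+ 2 = (Re w / normc w) ^+ 2.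
  rewrite /u !exprMn !exprVn.
  have -> : Re w ^+ 2 = normc w ^+ 2 - Im w ^+ 2 by rewrite nsq; ring.
  by field; lra.
have u21 : 0 < 1 - u ^+ 2 by rewrite u2 exprn_gt0// divr_gt0.
have u1 : -1 < u < 1 by apply/andP; split; nra.
have u1' : -1 <= u <= 1 by move: u1 => /andP[? ?]; apply/andP; split; lra.
exists (ln (normc w)), (asin u); split.
  by rewrite asin_gtNpi2 ?asin_ltpi2//; move: u1 => /andP[? ?]; apply/andP; split; lra.
rewrite /strip_map.
have -> : cexp (ln (normc w)) (asin u) = w.
  rewrite /cexp lnK ?posrE// cos_asin// asinK ?in_itv//= u2 sqrtr_sqr.
  rewrite ger0_norm ?divr_ge0 ?ltW// /u; case: (w) nw => a b nw /=.
  by congr (_ +i* _); rewrite mulrC mulfVK// gt_eqF.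
have -> : w + 1 = 2 / (1 - z) by rewrite /w; field.
by field.
Qed.

End Strip.

(** * Values near the unit circle stay away from interior values *)

Section Separation.
Variable (R : realType).
Local Notation Re := (@complex.Re R).
Local Notation Im := (@complex.Im R).
Implicit Types (z w e : R[i]) (x y t : R).

Variable phi : R -> R.
Hypothesis phi_nd : {homo phi : x y / x <= y}.
Hypothesis phi1 : forall x, `|phi x| <= 1.
Local Notation a := (cos_coef phi).

Definition cos_poly (N : nat) z : R[i] := \sum_(n < N) (a n.+1)%:C * z ^+ n.+1.

Lemma cos_poly_velocity (N : nat) (f : R -> R[i]) t df : has_velocity f t df ->
  has_velocity (fun s => cos_poly N (f s)) t
    ((\sum_(n < N) (n.+1%:R * a n.+1)%:C * f t ^+ n) * df).
Proof.
move=> hf; rewrite mulr_suml.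
apply: (@velocity_sum _ (fun n s => (a n.+1)%:C * f s ^+ n.+1)
  (fun n => (n.+1%:R * a n.+1)%:C * f t ^+ n * df)) => n.
apply: velocity_eq (velocityM (velocity_cst _ t) (velocityX n.+1 hf)) _.
by rewrite mul0r add0r /= [in RHS]rmorphM/= rmorph_nat; ring.
Qed.

Lemma has_velocity_continuous (f : R -> R[i]) t df : has_velocity f t df ->
  {for t, continuous (fun s => Re (f s))}.
Proof.
move=> [[h _] _]; apply: differentiable_continuous; exact/derivable1_diffP.
Qed.

(** The mean value theorem for the real function Re (conj e * psi_N) along a
    segment of direction e: its derivative is |e|^2 / 2 times the real part of
    (1 - z^2) psi_N'(z). *)
Lemma cos_poly_increment (N : nat) (x y dx dy t0 t1 rho : R) :
  t0 < t1 -> 0 <= rho < 1 ->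
  (forall t, t0 <= t <= t1 -> - (pi / 2) < y + t * dy < pi / 2 /\
     normc (strip_map (x + t * dx) (y + t * dy)) <= rho) ->
  Re (conjc (dx +i* dy) * (cos_poly N (strip_map (x + t1 * dx) (y + t1 * dy)) -
                           cos_poly N (strip_map (x + t0 * dx) (y + t0 * dy)))) <=
  (t1 - t0) * (dx ^+ 2 + dy ^+ 2) / 2 *
     (margin rho / 16 * a 1%N + 16 * rho ^+ N / margin rho).
Proof.
move=> t01 rho01 H; set e := dx +i* dy.
pose Z t := strip_map (x + t * dx) (y + t * dy); rewrite -/(Z t1) -/(Z t0).
pose P' z := \sum_(n < N) (n.+1%:R * a n.+1)%:C * z ^+ n.
pose F t := Re (conjc e * cos_poly N (Z t)).
pose F' t := (dx ^+ 2 + dy ^+ 2) / 2 * Re ((1 - Z t ^+ 2) * P' (Z t)).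
have vF t : t0 <= t <= t1 ->
    has_velocity (fun s => conjc e * cos_poly N (Z s)) t
      (conjc e * (P' (Z t) * (e * (1 - Z t ^+ 2) / 2))).
  move=> ht; have [hy _] := H t ht.
  have := velocityM (velocity_cst (conjc e) t)
     (cos_poly_velocity N (strip_map_velocity x dx hy)).
  by move=> h; apply: velocity_eq h _; rewrite mul0r add0r.
have dF t : t0 <= t <= t1 -> is_derive t 1 F (F' t).
  move=> ht; have [h _] := vF t ht.
  apply: is_derive_eq.
  have -> : conjc e * (P' (Z t) * (e * (1 - Z t ^+ 2) / 2)) =
    ((normc e ^+ 2 / 2)%:C) * ((1 - Z t ^+ 2) * P' (Z t)).
    have half (u : R) : (u / 2)%:C = u%:C / 2 :> R[i] by rewrite rmorphM/= fmorphV rmorph_nat.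
    rewrite half -mul_conjc; ring.
  by rewrite Re_realM normc_sq.
have cF : {within `[t0, t1], continuous F}.
  apply: continuous_in_subspaceT => t; rewrite inE/= in_itv/= => ht.
  exact: has_velocity_continuous (vF t ht).
have dFo t : t \in `]t0, t1[ -> is_derive t 1 F (F' t).
  by rewrite in_itv/= => /andP[h1 h2]; apply: dF; rewrite !ltW.
have [c] := @MVT _ F F' t0 t1 t01 dFo cF.
rewrite in_itv/= => /andP[c0 c1] E.
have ct : t0 <= c <= t1 by rewrite !ltW.
have -> : Re (conjc e * (cos_poly N (Z t1) - cos_poly N (Z t0))) = F t1 - F t0.
  by rewrite mulrBr ReB.
rewrite E /F'.
have := Re_derivative_le phi_nd phi1 N rho01 (H c ct).2; rewrite -/(Z c) -/(P' _) => hR.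
have -> : (t1 - t0) * (dx ^+ 2 + dy ^+ 2) / 2 * (margin rho / 16 * a 1%N + 16 * rho ^+ N / margin rho)
  = (dx ^+ 2 + dy ^+ 2) / 2 * (margin rho / 16 * a 1%N + 16 * rho ^+ N / margin rho) * (t1 - t0) by ring.
apply: ler_wpM2r; first lra.
by apply: ler_wpM2l => //; rewrite divr_ge0// addr_ge0 ?sqr_ge0.
Qed.

Variable psi : R[i] -> R[i].
Hypothesis psi_lim : forall z, normc z < 1 -> forall eps, 0 < eps ->
  exists N0, forall N, (N0 <= N)%N -> normc (cos_poly N z - psi z) <= eps.

(** The inequality between values of the partial sums passes to the limit; this
    replaces termwise differentiation of the series. *)
Lemma psi_increment (x y dx dy t0 t1 rho : R) :
  t0 < t1 -> 0 <= rho < 1 ->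
  (forall t, t0 <= t <= t1 -> - (pi / 2) < y + t * dy < pi / 2 /\
     normc (strip_map (x + t * dx) (y + t * dy)) <= rho) ->
  Re (conjc (dx +i* dy) * (psi (strip_map (x + t1 * dx) (y + t1 * dy)) -
                           psi (strip_map (x + t0 * dx) (y + t0 * dy)))) <=
  (t1 - t0) * (dx ^+ 2 + dy ^+ 2) / 2 * (margin rho / 16 * a 1%N).
Proof.
move=> t01 rho01 H; set e := dx +i* dy.
pose Z t := strip_map (x + t * dx) (y + t * dy); rewrite -/(Z t1) -/(Z t0).
have m0 := margin_gt0 rho01.
have [r0 r1] := andP rho01.
pose E := (t1 - t0) * (dx ^+ 2 + dy ^+ 2) / 2.
have E0 : 0 <= E.
  by rewrite /E; apply: divr_ge0 => //; apply: mulr_ge0; [lra|rewrite addr_ge0 ?sqr_ge0].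
rewrite -/E.
apply/ler_addgt0Pr => eps eps0.
pose d := eps / (E * 16 / margin rho + 2 * normc e + 1).
have n0 := normc_ge0 e.
have Em : 0 <= E * 16 / margin rho by apply: divr_ge0; [exact: mulr_ge0|exact: ltW].
have d0 : 0 < d by rewrite divr_gt0//; lra.
have z1 : normc (Z t1) < 1.
  by apply: le_lt_trans r1; apply: (H t1 _).2; rewrite lexx ltW.
have z0 : normc (Z t0) < 1.
  by apply: le_lt_trans r1; apply: (H t0 _).2; rewrite lexx ltW.
have [N1 HN1] := psi_lim z1 d0.
have [N0 HN0] := psi_lim z0 d0.
have [N2 HN2] : exists N2, forall N, (N2 <= N)%N -> rho ^+ N <= d.
  have /cvgrPdist_le/(_ _ d0)[N2 _ hN2] : (fun n => rho ^+ n) @ \oo --> (0 : R).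
    by apply: cvg_expr; rewrite ger0_norm.
  exists N2 => N /hN2; rewrite sub0r normrN ger0_norm// exprn_ge0//.
pose N := maxn N0 (maxn N1 N2).
have h0 := HN0 N (leq_maxl _ _).
have h1 : normc (cos_poly N (Z t1) - psi (Z t1)) <= d.
  by apply: HN1; rewrite /N !leq_max leqnn !orbT.
have h2 : rho ^+ N <= d by apply: HN2; rewrite /N !leq_max leqnn !orbT.
have := cos_poly_increment N t01 rho01 H; rewrite -/Z -/e -/E => hi.
have -> : psi (Z t1) - psi (Z t0) = (cos_poly N (Z t1) - cos_poly N (Z t0)) -
  ((cos_poly N (Z t1) - psi (Z t1)) - (cos_poly N (Z t0) - psi (Z t0))) by ring.
rewrite mulrBr ReB.
set D := _ - _ - (_ - _).
have hD : - Re (conjc e * D) <= normc e * (2 * d).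
  rewrite -ReN; apply: le_trans (ler_norm _) _; apply: le_trans (ler_Re_normc _) _.
  rewrite normc_opp normcM normc_conj; apply: ler_wpM2l => //.
  by apply: le_trans (normcB _ _) _; lra.
have hd : d * (E * 16 / margin rho + 2 * normc e + 1) = eps.
  by rewrite /d mulfVK// gt_eqF//; lra.
have he : E * (16 * rho ^+ N / margin rho) <= E * 16 / margin rho * d.
  have -> : E * (16 * rho ^+ N / margin rho) = E * 16 / margin rho * rho ^+ N by ring.
  exact: ler_wpM2l.
lra.
Qed.

(** Join z to w by a segment of the strip. Within a fixed radius s of z the
    decrease of Re (conj e * psi) is at least proportional to s |e|, and on the
    rest of the segment it does not turn back. A point w of modulus greater
    than rho lies outside that radius. *)
Lemma psi_separation z : a 1%N < 0 -> normc z < 1 ->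
  exists rho c, [/\ 0 <= rho < 1, 0 < c &
    forall w, rho < normc w < 1 -> c <= normc (psi w - psi z)].
Proof.
move=> a1 /strip_map_surj[x [y [hy ->]]].
(* Half the distance from x + i y to the boundary of the strip. *)
pose s := (pi / 2 - `|y|) / 2.
have yp : `|y| < pi / 2 by rewrite ltr_norml.
have s0 : 0 < s by rewrite /s; lra.
have [||rho rho01 Hrho] := @normc_strip_map_le R (`|x| + s) (`|y| + s).
- by rewrite addr_ge0// ltW.
- by rewrite addr_ge0 ?(ltW s0)//= /s; lra.
have m0 := margin_gt0 rho01.
exists rho, (s / 2 * (margin rho / 16 * - a 1%N)); split => //.
  apply: mulr_gt0; first by rewrite divr_gt0.
  by apply: mulr_gt0; [exact: divr_gt0|rewrite oppr_gt0].
move=> w /andP[rw /strip_map_surj[x' [y' [hy' E]]]]; subst w.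
(* L is the length of the segment and lam the parameter at distance s. *)
pose dx := x' - x; pose dy := y' - y.
pose L := normc (dx +i* dy).
have L0 : 0 <= L by exact: normc_ge0.
have nx := ler_norm x. have nx' := ler_norm (- x). have ny := ler_norm y.
have ny' := ler_norm (- y). rewrite !normrN in nx' ny'.
have adx : `|dx| <= L by exact: (ler_Re_normc (dx +i* dy)).
have ady : `|dy| <= L by exact: (ler_Im_normc (dx +i* dy)).
have sL : s < L.
  rewrite ltNge; apply/negP => Ls; move: rw; rewrite ltNge => /negP; apply.
  have dxs : `|dx| <= s by lra.
  have dys : `|dy| <= s by lra.
  move: dxs dys; rewrite !ler_norml /dx /dy => /andP[? ?] /andP[? ?].
  by apply: Hrho; apply/andP; split; lra.
pose lam := s / L.
have Lp : 0 < L by lra.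
have lam0 : 0 < lam by rewrite divr_gt0.
have lam1 : lam < 1 by rewrite ltr_pdivrMr// mul1r.
have lL : lam * L = s by rewrite /lam mulfVK// gt_eqF.
have Lsq : dx ^+ 2 + dy ^+ 2 = L ^+ 2 by rewrite /L normc_sq.
pose Z t := strip_map (x + t * dx) (y + t * dy).
have Z0 : Z 0 = strip_map x y by rewrite /Z !mul0r !addr0.
have Z1 : Z 1 = strip_map x' y' by rewrite /Z !mul1r /dx /dy !addrA !(addrC _ x') !(addrC _ y') !addrK.
have yt t : 0 <= t <= 1 -> - (pi / 2) < y + t * dy < pi / 2.
  move=> /andP[t0 t1]; move: hy hy' => /andP[h1 h2] /andP[h3 h4].
  have -> : y + t * dy = (1 - t) * y + t * y' by rewrite /dy; ring.
  have cv (p u v : R) : p < u -> p < v -> p < (1 - t) * u + t * v.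
    move: t0; rewrite le_eqVlt => /predU1P[<-|t0] pu pv; first lra.
    have : 0 < t * (v - p) by rewrite mulr_gt0 ?subr_gt0.
    have : 0 <= (1 - t) * (u - p) by rewrite mulr_ge0 ?subr_ge0// ltW.
    lra.
  rewrite cv//=; have := cv (- (pi / 2)) (- y) (- y'); rewrite !ltrN2 => /(_ h2 h4).
  lra.
have first : Re (conjc (dx +i* dy) * (psi (Z lam) - psi (Z 0))) <=
    (lam - 0) * (dx ^+ 2 + dy ^+ 2) / 2 * (margin rho / 16 * a 1%N).
  apply: psi_increment => // t /andP[t0 t1]; split.
    by apply: yt; rewrite t0 (le_trans t1)// ltW.
  have tL : t * L <= s by rewrite -lL ler_wpM2r.
  have tdx : `|t * dx| <= s by rewrite normrM (ger0_norm t0); nra.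
  have tdy : `|t * dy| <= s by rewrite normrM (ger0_norm t0); nra.
  move: tdx tdy; rewrite !ler_norml => /andP[? ?] /andP[? ?].
  by apply: Hrho; apply/andP; split; lra.
have second : Re (conjc (dx +i* dy) * (psi (Z 1) - psi (Z lam))) <= 0.
  have [||rho' rho01' Hrho'] := @normc_strip_map_le R (`|x| + `|x'|) (Num.max `|y| `|y'|).
  - by rewrite addr_ge0.
  - rewrite le_max normr_ge0/= gt_max yp/= ltr_norml; exact: hy'.
  have := @psi_increment x y dx dy lam 1 rho' lam1 rho01'.
  have m0' := margin_gt0 rho01'.
  rewrite -/(Z 1) -/(Z lam) => h; apply: le_trans (h _) _; last first.
    apply: mulr_ge0_le0.
      by apply: divr_ge0 => //; apply: mulr_ge0; [lra|rewrite addr_ge0 ?sqr_ge0].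
    by apply: mulr_ge0_le0; [rewrite ltW// divr_gt0|exact: ltW].
  move=> t /andP[t0 t1]; have tp : 0 <= t by lra.
  split; first by apply: yt; rewrite tp.
  have xx' := ler_norm x'. have xx := ler_norm (- x'). rewrite normrN in xx.
  have M1 : `|y| <= Num.max `|y| `|y'| by rewrite le_max lexx.
  have M2 : `|y'| <= Num.max `|y| `|y'| by rewrite le_max lexx orbT.
  have -> : x + t * dx = (1 - t) * x + t * x' by rewrite /dx; ring.
  have -> : y + t * dy = (1 - t) * y + t * y' by rewrite /dy; ring.
  set M := Num.max _ _ in M1 M2 Hrho'.
  have ax := normr_ge0 x. have ax' := normr_ge0 x'.
  have cl (p u v : R) : p <= u -> p <= v -> p <= (1 - t) * u + t * v.
    move=> pu pv; have : 0 <= t * (v - p) by rewrite mulr_ge0 ?subr_ge0.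
    have : 0 <= (1 - t) * (u - p) by rewrite mulr_ge0 ?subr_ge0.
    lra.
  have cr (p u v : R) : u <= p -> v <= p -> (1 - t) * u + t * v <= p.
    by move=> pu pv; have := @cl (- p) (- u) (- v); rewrite !lerN2 => /(_ pu pv); lra.
  move: (M) M1 M2 Hrho' => B M1 M2 Hrho'.
  apply: Hrho'; apply/andP; split.
  - by apply: cl; lra.
  - by apply: cr; lra.
  - by apply: cl; move: M1 M2; rewrite !ler_norml => /andP[? ?] /andP[? ?].
  - by apply: cr; move: M1 M2; rewrite !ler_norml => /andP[? ?] /andP[? ?].
have total : Re (conjc (dx +i* dy) * (psi (Z 1) - psi (Z 0))) <=
    L * (s / 2 * (margin rho / 16 * a 1%N)).
  have -> : psi (Z 1) - psi (Z 0) = (psi (Z 1) - psi (Z lam)) + (psi (Z lam) - psi (Z 0)) by ring.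
  rewrite mulrDr ReD; apply: le_trans (lerD second first) _.
  have lLL : lam * L ^+ 2 = s * L by rewrite expr2 mulrA lL.
  rewrite add0r subr0 Lsq lLL; lra.
rewrite -Z0 -Z1.
have := ler_Re_normc (conjc (dx +i* dy) * (psi (Z 1) - psi (Z 0))).
rewrite normcM normc_conj -/L ler_norml => /andP[hl _].
rewrite -(ler_pM2l Lp); lra.
Qed.

End Separation.

(** * Mean squares over roots of unity *)

Section MeanSquare.
Variable (R : realType).
Local Notation Re := (@complex.Re R).
Local Notation Im := (@complex.Im R).
Implicit Types (z w e : R[i]) (x y t : R).

Definition cis x : R[i] := cos x +i* sin x.

Lemma cisX x n : cis x ^+ n = cis (n%:R * x).
Proof.
elim: n => [|n IH]; first by rewrite expr0 mul0r /cis cos0 sin0.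
rewrite exprS IH -natr1 mulrDl mul1r addrC.
by apply/eqP; rewrite eq_complex/= cosD sinD; apply/andP; split; apply/eqP; ring.
Qed.

Lemma cis_conj x : cis x * conjc (cis x) = 1.
Proof. by rewrite mul_conjc normc_sq /= cos2Dsin2. Qed.

Lemma normc_cis x : normc (cis x) = 1.
Proof. by rewrite /= cos2Dsin2 sqrtr1. Qed.

Lemma cis_neq1 x : 0 < x < pi *+ 2 -> cis x != 1.
Proof.
move=> /andP[x0 x1]; apply/eqP => /(congr1 Re)/=.
have -> : x = (x / 2) *+ 2 by rewrite -mulr_natr; field.
rewrite cos_mulr2n cos2sin2 => h.
have : 0 < sin (x / 2) by apply: sin_gt0_pi; apply/andP; split; lra.
by rewrite !mulr2n in h; nra.
Qed.

(** By orthogonality of characters, the average of the squared modulus over the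
    r-multiples of the roots of unity of order N + 1 is the right-hand side, so
    some term of the average is at most that. *)
Lemma mean_square_point (N : nat) (c : nat -> R) (r : R) : 0 <= r ->
  exists2 z, normc z = r &
    normc (\sum_(n < N) (c n)%:C * z ^+ n.+1) ^+ 2 <= \sum_(n < N) (c n * r ^+ n.+1) ^+ 2.
Proof.
(* The exponents 1, ..., N are distinct modulo M. *)
move=> r0; pose M := N.+1.
pose om := cis (pi *+ 2 / M%:R).
have M0 : 0 < M%:R :> R by rewrite ltr0n.
have omM : om ^+ M = 1.
  by rewrite cisX mulrC mulfVK ?gt_eqF// /cis cos2pi sin2pi.
have om0 : om != 0 by rewrite -normc_eq0 normc_cis oner_eq0.
have om_inj i j : (i < j)%N -> (j < M)%N -> om ^+ j != om ^+ i.
  move=> ij jM; rewrite -(subnKC (ltnW ij)) exprD -{2}(mulr1 (om ^+ i)).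
  apply/eqP => /(mulfI (expf_neq0 i om0)); apply/eqP; rewrite cisX; apply: cis_neq1.
  have k0 : (0 < j - i)%N by rewrite subn_gt0.
  have kM : (j - i < M)%N by apply: leq_ltn_trans jM; exact: leq_subr.
  rewrite mulrA; apply/andP; split.
    by rewrite divr_gt0// mulr_gt0 ?ltr0n// mulrn_wgt0// pi_gt0.
  have tp0 : 0 < pi *+ 2 :> R by rewrite mulrn_wgt0// pi_gt0.
  by rewrite ltr_pdivrMr// [ltRHS]mulrC ltr_pM2r// ltr_nat.
pose d n := c n * r ^+ n.+1.
pose P z := \sum_(n < N) (c n)%:C * z ^+ n.+1.
pose zj j := r%:C * om ^+ j.
have Pz : forall i, P (zj i) = \sum_(n < N) (d n)%:C * (om ^+ n.+1) ^+ i.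
  move=> i; apply: eq_bigr => n _; rewrite /zj /d exprMn rmorphM/= rmorphXn/= mulrA.
  by rewrite -!exprM mulnC.
pose zeta (n m : nat) := om ^+ n.+1 * conjc (om ^+ m.+1).
have zetaM n m : zeta n m ^+ M = 1.
  rewrite /zeta exprMn -exprM mulnC exprM omM expr1n mul1r.
  by rewrite -rmorphXn/= -exprM mulnC exprM omM expr1n conjc1.
have omJ k : om ^+ k * conjc (om ^+ k) = 1.
  by rewrite rmorphXn/= -exprMn cis_conj expr1n.
have zeta1 n : zeta n n = 1 by exact: omJ.
have zeta_neq1 n m : (n < N)%N -> (m < N)%N -> n != m -> zeta n m != 1.
  move=> nN mN nm; apply/eqP => /(congr1 ( *%R (om ^+ m.+1))).
  rewrite /zeta mulrCA omJ !mulr1.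
  move: nm; rewrite neq_ltn => /orP[] lt; apply/eqP.
    by rewrite eq_sym om_inj.
  by rewrite om_inj.
have sum_zeta n m : (n < N)%N -> (m < N)%N ->
    \sum_(j < M) zeta n m ^+ j = if n == m then M%:R else 0.
  move=> nN mN; have [->|nm] := eqVneq n m.
    rewrite zeta1 (eq_bigr (fun=> 1)) ?sumr_const ?card_ord//.
    by move=> j _; rewrite expr1n.
  have := subrX1 (zeta n m) M; rewrite zetaM subrr => /esym/eqP.
  by rewrite mulf_eq0 subr_eq0 (negbTE (zeta_neq1 _ _ _ _ nm))//= => /eqP.
have total : \sum_(j < M) normc (P (zj j)) ^+ 2 = M%:R * \sum_(n < N) d n ^+ 2.
  apply: (@complexI R); rewrite rmorph_sum/= rmorphM/= rmorph_nat rmorph_sum/=.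
  transitivity (\sum_(j < M) \sum_(n < N) \sum_(m < N)
      (d n)%:C * (d m)%:C * zeta n m ^+ j).
    apply: eq_bigr => j _; rewrite -mul_conjc Pz rmorph_sum/= mulr_suml.
    apply: eq_bigr => n _; rewrite mulr_sumr; apply: eq_bigr => m _.
    rewrite [conjc (_ * _)]rmorphM/= oppr0 rmorphXn/= /zeta exprMn.
    have -> : (d m)%:C = d m +i* 0 by [].
    ring.
  transitivity (\sum_(n < N) \sum_(m < N) \sum_(j < M)
      (d n)%:C * (d m)%:C * zeta n m ^+ j).
    apply: etrans (exchange_big _ _ _ _ _ _) _.
    by apply: eq_bigr => n _; exact: exchange_big.
  rewrite mulr_sumr; apply: eq_bigr => n _.
  transitivity (\sum_(m < N) (if n == m then (d n)%:C * (d n)%:C * M%:R else 0)).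
    apply: eq_bigr => m _; rewrite -mulr_sumr sum_zeta// -val_eqE/=.
    by case: eqP => [->|_] //; rewrite mulr0.
  rewrite -big_mkcond/= (big_pred1 n); first by rewrite [LHS]mulrC [_ ^+ 2]expr2 [in RHS]rmorphM.
  by move=> m; rewrite eq_sym.
have [[j hj]|] := pselect (exists j : 'I_M, normc (P (zj j)) ^+ 2 <= \sum_(n < N) d n ^+ 2).
  exists (zj j) => //.
  by rewrite /zj normcM normcX normc_cis expr1n mulr1 normc_real ger0_norm.
move=> /forallNP no.
have : \sum_(j < M) (\sum_(n < N) d n ^+ 2) < \sum_(j < M) normc (P (zj j)) ^+ 2.
  apply: ltr_sum; first by apply/hasP; exists ord0; rewrite ?mem_index_enum.
  by move=> j _; rewrite ltNge; apply/negP/no.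
by rewrite sumr_const card_ord total mulr_natl ltxx.
Qed.
End MeanSquare.

(** * Convergence of the power series *)

Section ComplexLimit.
Variable (R : realType).
Local Notation Re := (@complex.Re R).
Local Notation Im := (@complex.Im R).
Implicit Types (z w e : R[i]).

Lemma normc_le_parts z : normc z <= `|Re z| + `|Im z|.
Proof.
have h0 := normr_ge0 (Re z); have h1 := normr_ge0 (Im z).
rewrite -(@ler_pXn2r _ 2)// ?nnegrE ?normc_ge0 ?addr_ge0//.
rewrite normc_sq -(real_normK (num_real (Re z))) -(real_normK (num_real (Im z))).
by nra.
Qed.

Lemma normr_normc z : (`|z| : R[i]) = (normc z)%:C.
Proof. by []. Qed.

(** Convergence in the plane, where positive radii are complex numbers, from
    convergence with real radii. *)
Lemma complex_limn (u : nat -> R[i]) (l : R[i]) :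
  (forall eps : R, 0 < eps -> exists N0, forall N, (N0 <= N)%N -> normc (u N - l) <= eps) ->
  limn (u : nat -> R[i]^o) = l.
Proof.
move=> H; apply: cvg_lim; first exact: norm_hausdorff.
apply/cvgrPdist_le => e e0.
have [E e0'] : e = (Re e)%:C /\ 0 < Re e.
  by move: e0; rewrite ltcE/=; case: e => x y /= /andP[/eqP -> ?].
have [N0 HN0] := H _ e0'.
exists N0 => // N /HN0 h.
by rewrite E distrC normr_normc lecR.
Qed.

End ComplexLimit.

Section GrossSeries.
Variable (R : realType).
Local Notation Re := (@complex.Re R).
Local Notation Im := (@complex.Im R).
Implicit Types (z w e : R[i]).
Variable phi : R -> R.
Hypothesis phi_nd : {homo phi : x y / x <= y}.
Hypothesis phi1 : forall x, `|phi x| <= 1.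
Local Notation a := (cos_coef phi).

Definition cos_series (z : R[i]) : R[i] :=
  limn (fun N => \sum_(1 <= n < N) ((a n)%:C * z ^+ n) : R[i]^o).

Lemma cos_coef_le2 n : `|a n.+1| <= 2.
Proof.
have := cos_coef_decay phi_nd phi1 n.+1; apply: le_trans.
by rewrite ler_peMl// ler1n.
Qed.

Lemma cos_poly_term_le n z : normc ((a n.+1)%:C * z ^+ n.+1) <= 2 * normc z ^+ n.+1.
Proof.
rewrite normcM normcX normc_real ler_wpM2r//; last exact: cos_coef_le2.
by rewrite exprn_ge0// normc_ge0.
Qed.

(** Uniformity in z matters: the point of a circle at which a truncation is
    small depends on the degree of the truncation. *)
Lemma cos_poly_tail (rho : R) (N k : nat) z : 0 <= rho < 1 -> normc z <= rho ->
  normc (cos_poly phi (N + k) z - cos_poly phi N z) <= 2 * rho ^+ N / (1 - rho).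
Proof.
move=> /andP[r0 r1] zr.
have r1' : 0 < 1 - rho by lra.
suff : normc (cos_poly phi (N + k) z - cos_poly phi N z) <=
    2 * (rho ^+ N - rho ^+ (N + k)) / (1 - rho).
  move=> h; apply: le_trans h _; rewrite ler_pM2r ?invr_gt0// ler_pM2l//.
  by rewrite gerBl exprn_ge0.
elim: k => [|k IH].
  by rewrite addn0 !subrr mulr0 mul0r ComplexField.Normc.normc0.
rewrite addnS {1}/cos_poly big_ord_recr/= -/(cos_poly phi (N + k) z) addrAC.
apply: le_trans (normcD _ _) _; apply: le_trans (lerD IH (cos_poly_term_le _ _)) _.
have zk : normc z ^+ (N + k).+1 <= rho ^+ (N + k).
  apply: le_trans (_ : rho ^+ (N + k).+1 <= _).
    by apply: lerXn2r; rewrite ?nnegrE ?normc_ge0.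
  by rewrite exprS ler_piMl ?exprn_ge0// ltW.
have -> : 2 * (rho ^+ N - rho ^+ (N + k).+1) / (1 - rho) =
   2 * (rho ^+ N - rho ^+ (N + k)) / (1 - rho) + 2 * rho ^+ (N + k).
  by rewrite exprS; field; lra.
by rewrite lerD2l ler_pM2l.
Qed.

Lemma cos_poly_cvg z : normc z < 1 -> exists l, forall eps : R, 0 < eps ->
  exists N0, forall N, (N0 <= N)%N -> normc (cos_poly phi N z - l) <= eps.
Proof.
move=> z1.
have cv (p : R[i] -> R) : (forall w, `|p w| <= normc w) ->
    cvgn (series (fun n => p ((a n.+1)%:C * z ^+ n.+1))).
  move=> hp; apply: normed_cvg.
  apply: (@series_le_cvg _ _ (geometric 2 (normc z))) => //=.
  - by move=> n /=; rewrite mulr_ge0// exprn_ge0// normc_ge0.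
  - move=> n /=; apply: le_trans (hp _) _; apply: le_trans (cos_poly_term_le _ _) _.
    by rewrite ler_pM2l// exprS ler_piMl ?exprn_ge0 ?normc_ge0// ltW.
  - by apply: is_cvg_geometric_series; rewrite ger0_norm ?normc_ge0.
have cR := cv _ (@ler_Re_normc R); have cI := cv _ (@ler_Im_normc R).
exists (limn (series (fun n => Re ((a n.+1)%:C * z ^+ n.+1))) +i*
        limn (series (fun n => Im ((a n.+1)%:C * z ^+ n.+1)))) => eps eps0.
have e2 : 0 < eps / 2 by rewrite divr_gt0.
have /cvgrPdist_le/(_ _ e2)[N1 _ h1] := cR.
have /cvgrPdist_le/(_ _ e2)[N2 _ h2] := cI.
exists (maxn N1 N2) => N; rewrite geq_max => /andP[/h1 {}h1 /h2 {}h2].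
apply: le_trans (normc_le_parts _) _; rewrite ReB ImB.
rewrite distrC in h1; rewrite distrC in h2.
rewrite {1}/cos_poly Re_sum -[X in `|X - _|](big_mkord xpredT (fun n => Re ((a n.+1)%:C * z ^+ n.+1))).
have -> : Im (cos_poly phi N z) = \sum_(0 <= n < N) Im ((a n.+1)%:C * z ^+ n.+1).
  rewrite big_mkord; apply: (big_morph Im) => // u v; exact: ImD.
rewrite /series/= in h1 h2 *; lra.
Qed.

Lemma cos_seriesP z : normc z < 1 -> forall eps : R, 0 < eps ->
  exists N0, forall N, (N0 <= N)%N -> normc (cos_poly phi N z - cos_series z) <= eps.
Proof.
move=> /cos_poly_cvg[l hl]; suff -> : cos_series z = l by [].
apply: complex_limn => eps /hl[N0 hN0]; exists N0.+1 => -[//|N] NN.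
by rewrite big_add1/= big_mkord; exact: hN0.
Qed.

Lemma cos_series_tail (rho : R) (N : nat) z : 0 <= rho < 1 -> normc z <= rho ->
  normc (cos_series z) <= normc (cos_poly phi N z) + 2 * rho ^+ N / (1 - rho).
Proof.
move=> rho01 zr; apply/ler_addgt0Pr => eps eps0.
have z1 : normc z < 1 by apply: le_lt_trans zr _; case/andP: rho01.
have [N0 /(_ (N + N0)%N (leq_addl _ _)) h] := cos_seriesP z1 eps0.
have h2 := cos_poly_tail N N0 rho01 zr.
have -> : cos_series z = (cos_poly phi N z) + (cos_poly phi (N + N0) z - cos_poly phi N z)
   - (cos_poly phi (N + N0) z - cos_series z) by ring.
apply: le_trans (normcB _ _) _; apply: le_trans (lerD (normcD _ _) h) _; lra.
Qed.

End GrossSeries.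

(** * A value that the power series misses *)

Section Misses.
Variable (R : realType).
Local Notation Re := (@complex.Re R).
Local Notation Im := (@complex.Im R).
Implicit Types (z w e : R[i]).
Variable phi : R -> R.
Hypothesis phi_nd : {homo phi : x y / x <= y}.
Hypothesis phi1 : forall x, `|phi x| <= 1.
Local Notation a := (cos_coef phi).
Local Notation psi := (cos_series phi).
Hypothesis a1_small : `|a 1%N| <= 64^-1.

(** The first 128 terms are at most (1/64)^2 each, and the other ones are at
    most (2 / (n + 1))^2, hence telescope to at most 4 / 128; each part is at
    most 1/32. *)
Lemma sum_sq_cos_coef_le (N : nat) : \sum_(n < N) a n.+1 ^+ 2 <= 16^-1.
Proof.
have h1 n : a n.+1 ^+ 2 <= (64^-1) ^+ 2.
  rewrite -(real_normK (num_real (a n.+1))); apply: lerXn2r; rewrite ?nnegrE ?invr_ge0//.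
  apply: le_trans (cos_coef_dominated phi_nd phi1 (ltn0Sn n)) _.
  by apply: le_trans a1_small; rewrite -normrN ler_norm.
have h2 n : (0 < n)%N -> a n.+1 ^+ 2 <= 4 / n%:R - 4 / n.+1%:R.
  move=> n0; have n0' : 0 < n%:R :> R by rewrite ltr0n.
  have := cos_coef_decay phi_nd phi1 n.+1.
  rewrite -(real_normK (num_real (a n.+1))) -natr1.
  have := normr_ge0 (a n.+1); set b := `|a n.+1| => b0 hb.
  have -> : 4 / n%:R - 4 / (n%:R + 1) = 4 / (n%:R * (n%:R + 1)) :> R by field; lra.
  rewrite ler_pdivlMr; last by apply: mulr_gt0 => //; lra.
  have : ((n%:R + 1) * b) ^+ 2 <= 2 ^+ 2 by apply: lerXn2r; rewrite ?nnegrE ?mulr_ge0//; lra.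
  by nra.
(* The first bound is used for n < 128 and the telescoping one beyond. *)
have small M : \sum_(n < M) a n.+1 ^+ 2 <= M%:R * (64^-1) ^+ 2.
  elim: M => [|M IH]; first by rewrite big_ord0 mul0r.
  by rewrite big_ord_recr/= -natr1 mulrDl mul1r lerD.
have large k : \sum_(n < 128 + k) a n.+1 ^+ 2 <=
    128%:R * (64^-1) ^+ 2 + 4 / 128%:R - 4 / (128 + k)%:R.
  elim: k => [|k IH]; first by rewrite addn0; have := small 128%N; lra.
  rewrite addnS big_ord_recr; apply: le_trans (lerD IH (h2 (128 + k)%N isT)) _.
  by rewrite addrA subrK.
have [N128|N128] := leqP N 128.
  apply: le_trans (small N) _.
  have h : N%:R <= 128%:R :> R by rewrite ler_nat.
  by have := ler_wpM2r (sqr_ge0 (64^-1 : R)) h; lra.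
rewrite -(subnKC (ltnW N128)); apply: le_trans (large _) _.
have : 0 <= 4 / (128 + (N - 128))%:R :> R by rewrite divr_ge0.
lra.
Qed.

Lemma cos_series_small_point (r : R) : 0 <= r < 1 ->
  exists2 z, normc z = r & normc (psi z) <= 2^-1.
Proof.
move=> /[dup] r01 /andP[r0 r1].
have [N hN] : exists N, 2 * r ^+ N / (1 - r) <= 4^-1.
  have d0 : 0 < (1 - r) / 8 by rewrite divr_gt0// subr_gt0.
  have /cvgrPdist_le/(_ _ d0)[N _ /(_ N (leqnn N))] : (fun n => r ^+ n) @ \oo --> (0 : R).
    by apply: cvg_expr; rewrite ger0_norm.
  rewrite sub0r normrN ger0_norm ?exprn_ge0// => h; exists N.
  by rewrite ler_pdivrMr ?subr_gt0//; lra.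
have [z zr hz] := mean_square_point N (fun n => a n.+1) r0.
exists z => //.
have zr' : normc z <= r by rewrite zr.
apply: le_trans (cos_series_tail phi_nd phi1 N r01 zr') _.
suff : normc (cos_poly phi N z) <= 4^-1 by lra.
rewrite -(@ler_pXn2r _ 2)// ?nnegrE ?normc_ge0 ?invr_ge0//.
apply: le_trans hz _; apply: le_trans (_ : 16^-1 <= _); last lra.
apply: le_trans (sum_sq_cos_coef_le N); apply: ler_sum => n _.
rewrite exprMn ler_piMr ?sqr_ge0//.
by rewrite -exprM exprn_ile1// ltW.
Qed.

(** Points of small image near the circle: their images accumulate at w, and if
    w were the value at z, then [psi_separation] would keep the images of points
    near the circle away from w. If a 1 = 0, the series is identically 0. *)
Lemma cos_series_misses : exists w,
  [/\ `|Re w| <= 2^-1, `|Im w| <= 2^-1 & forall z, normc z < 1 -> psi z <> w].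
Proof.
have [a0|a0] := eqVneq (a 1%N) 0.
  have az n : a n.+1 = 0.
    apply/eqP; rewrite -normr_le0.
    by have := cos_coef_dominated phi_nd phi1 (ltn0Sn n); rewrite a0 oppr0.
  exists (2^-1)%:C; split; rewrite /= ?normr0 ?ger0_norm ?invr_ge0// => z z1.
  have -> : psi z = 0.
    apply: complex_limn => eps e0; exists 0%N => -[_|N _].
      by rewrite big_geq// subrr ComplexField.Normc.normc0 ltW.
    rewrite big_add1/= big_mkord big1 ?subrr ?ComplexField.Normc.normc0 ?ltW// => n _.
    by rewrite az mul0r.
  by move=> /(congr1 Re)/= /eqP; rewrite eq_sym invr_eq0 pnatr_eq0.
have a1neg : a 1%N < 0.
  rewrite lt_neqAle a0 -oppr_ge0; apply: le_trans (cos_coef_dominated phi_nd phi1 (ltn0Sn 0)).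
  exact: normr_ge0.
pose r (k : nat) : R := 1 - k.+2%:R^-1.
have r01 k : 0 <= r k < 1.
  rewrite /r; have : 0 < k.+2%:R^-1 :> R by rewrite invr_gt0 ltr0n.
  have : k.+2%:R^-1 <= 1 :> R by rewrite invf_le1 ?ltr0n// ler1n.
  by move: (k.+2%:R^-1) => i ? ?; apply/andP; split; lra.
have /choice[zk hzk] : forall k, exists z, normc z = r k /\ normc (psi z) <= 2^-1.
  by move=> k; have [z ? ?] := cos_series_small_point (r01 k); exists z.
pose u k : R * R := (Re (psi (zk k)), Im (psi (zk k))).
pose I : set R := `[- 2^-1, 2^-1]%classic.
have cK : compact (I `*` I) by apply: compact_setX; exact: segment_compact.
have uK k : (I `*` I) (u k).
  have [_ h] := hzk k; rewrite /I; split => /=; rewrite in_itv/= -ler_norml.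
    exact: le_trans (ler_Re_normc _) h.
  exact: le_trans (ler_Im_normc _) h.
have [[p q] [[Ip Iq] cl]] := cK (u @ \oo) _ (filterE _ uK).
exists (p +i* q); split => /=.
- by move: Ip; rewrite /I/= in_itv/= -ler_norml.
- by move: Iq; rewrite /I/= in_itv/= -ler_norml.
move=> z z1 hz.
have [rho [c [rho01 c0 hsep]]] := psi_separation phi_nd phi1 (cos_seriesP phi_nd phi1) a1neg z1.
have [K0 hK0] : exists K0 : nat, forall k, (K0 <= k)%N -> rho < r k.
  have d0 : 0 < 1 - rho by rewrite subr_gt0; case/andP: rho01.
  exists (Num.truncn (1 - rho)^-1) => k Kk.
  have : (1 - rho)^-1 < k.+2%:R.
    by apply: lt_le_trans (truncnS_gt _) _; rewrite ler_nat ltnS ltnW.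
  move=> h.
  have : k.+2%:R^-1 < 1 - rho.
    by rewrite -[ltRHS]invrK ltf_pV2// posrE ?ltr0n// invr_gt0.
  by rewrite /r; move: (k.+2%:R^-1) => i ?; lra.
have c4 : 0 < c / 4 by rewrite divr_gt0.
have [||v [[k Kk <-] [/= h1 h2]]] := cl (u @` [set k | (K0 <= k)%N]) (ball p (c / 4) `*` ball q (c / 4)).
- by exists K0 => // k Kk; exists k.
- by exists (ball p (c / 4), ball q (c / 4)) => //; split; exact: nbhsx_ballx.
have [zr _] := hzk k.
have := hsep (zk k); rewrite zr hK0//= => /(_ (proj2 (andP (r01 k)))).
apply/negP; rewrite -ltNge; apply: le_lt_trans (normc_le_parts _) _.
rewrite ReB ImB hz/= distrC [X in _ + X]distrC.
move: h1 h2; rewrite /ball/= => h1 h2; lra.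
Qed.

End Misses.

(** * The Gross domain of a concentrated law *)

Section Quantile.
Variable (R : realType).
Local Notation Re := (@complex.Re R).
Local Notation Im := (@complex.Im R).
Local Notation leb := (@lebesgue_measure R).
Variable mu : set R -> \bar R.
Variables (eps delta : R).
Hypothesis eps0 : 0 <= eps.
Hypothesis delta01 : 0 < delta < 2^-1.
Hypothesis mu_hi : (1%:E <= mu `]-oo, 1%R]%classic)%E.
Hypothesis mu_lo : forall x : R, x < -1 -> (mu `]-oo, x]%classic <= 0)%E.
Hypothesis mu_mid : ((1 - delta)%:E <= mu `]-oo, eps]%classic)%E.
Hypothesis mu_left : forall x : R, x < - eps -> (mu `]-oo, x]%classic <= delta%:E)%E.

Let S (u : R) := [set x | (u%:E <= mu `]-oo, x]%classic)%E].

Let S1 u : u < 1 -> S u 1.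
Proof. by move=> u1; rewrite /S/=; apply: le_trans mu_hi; rewrite lee_fin ltW. Qed.

Let Slb u : 0 < u -> lbound (S u) (-1).
Proof.
move=> u0 x Sx; rewrite leNgt; apply/negP => x1.
by have := le_trans Sx (mu_lo x1); rewrite lee_fin leNgt u0.
Qed.

Lemma quantile_itv u : 0 < u < 1 -> -1 <= quantile mu u <= 1.
Proof.
move=> /andP[u0 u1]; apply/andP; split.
  by apply: lb_le_inf; [exists 1; exact: S1|exact: Slb].
by apply: ge_inf; [exists (-1); exact: Slb|exact: S1].
Qed.

(** The quantile is an infimum over a set that shrinks as u grows. *)
Lemma quantile_nondecreasing u v : 0 < u -> u <= v -> v < 1 ->
  quantile mu u <= quantile mu v.
Proof.
move=> u0 uv v1; apply: lb_le_inf; first by exists 1; exact: S1.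
move=> x Sx; apply: ge_inf; first by exists (-1); exact: Slb.
by rewrite /S/=; apply: le_trans Sx; rewrite lee_fin.
Qed.

Lemma quantile_mid u : delta < u <= 1 - delta -> `|quantile mu u| <= eps.
Proof.
move=> /andP[u0 u1]; move: delta01 => /andP[d0 d1].
rewrite ler_norml; apply/andP; split.
  apply: lb_le_inf; first by exists 1; apply: S1; lra.
  move=> x Sx; rewrite leNgt; apply/negP => x1.
  by have := le_trans Sx (mu_left x1); rewrite lee_fin leNgt u0.
apply: ge_inf; first by exists (-1); apply: Slb; lra.
by apply: le_trans mu_mid; rewrite lee_fin.
Qed.

(** Outside (0, pi) the quantile formula has dummy values; the constants make
    the function monotone on the whole line. *)
Definition boundary_fun (x : R) : R :=
  if x <= 0 then -1 else if pi <= x then 1 else quantile mu (x / pi).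

Let p0 := pi_gt0 R.

Let scaled (x : R) : 0 < x -> x < pi -> 0 < x / pi < 1.
Proof. by move=> x0 x1; rewrite divr_gt0//= ltr_pdivrMr// mul1r. Qed.

Lemma boundary_fun_le1 x : `|boundary_fun x| <= 1.
Proof.
rewrite /boundary_fun; have [x0|x0] := leP x 0; first by rewrite normrN1.
have [x1|x1] := leP pi x; first by rewrite normr1.
by rewrite ler_norml quantile_itv// scaled.
Qed.

Lemma boundary_fun_nd : {homo boundary_fun : x y / x <= y}.
Proof.
move=> x y xy; have := boundary_fun_le1 x; have := boundary_fun_le1 y.
rewrite !ler_norml /boundary_fun.
have [x0|x0] := leP x 0; first by move=> /andP[].
have [y0|y0] := leP y 0; first lra.
have [y1|y1] := leP pi y; first by move=> _ /andP[].
have [x1|x1] := leP pi x; first lra.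
move=> _ _; apply: quantile_nondecreasing.
- by case/andP: (scaled x0 x1).
- by rewrite ler_pM2r// invr_gt0.
- by case/andP: (scaled y0 y1).
Qed.

Lemma gross_coefE n : gross_coef mu n = cos_coef boundary_fun n.
Proof.
rewrite /gross_coef /cos_coef; congr (_ * _); apply: eq_Rintegral => x.
rewrite inE/= in_itv/= => /andP[x0 x1].
by rewrite /boundary_fun leNgt x0/= leNgt x1.
Qed.

(** The boundary function is at most eps except on two intervals of length
    delta * pi at the ends of (0, pi), where it is at most 1. *)
Lemma cos_coef1_le : `|cos_coef boundary_fun 1| <= 2 * eps + 4 * delta.
Proof.
move: delta01 => /andP[d0 d1]; have pp := pi_gt0 R.
have mI : measurable (`]0, pi[%classic : set R) by [].
pose A : set R := `]0, delta * pi]%classic. pose B : set R := `[pi - delta * pi, pi[%classic.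
have intc : leb.-integrable `]0, pi[ (EFin \o (fun=> eps)).
  by apply: continuous_itv_integrable => x; exact: cst_continuous.
have mA : measurable A by exact: measurable_itv.
have mB : measurable B by exact: measurable_itv.
have dp : delta * pi < pi / 2 by rewrite mulrC ltr_pM2l.
have dp0 : 0 < delta * pi by rewrite mulr_gt0.
have subA : A `<=` `]0, pi[ by move=> x; rewrite /A/= !in_itv/= => /andP[? ?]; apply/andP; split; lra.
have subB : B `<=` `]0, pi[ by move=> x; rewrite /B/= !in_itv/= => /andP[? ?]; apply/andP; split; lra.
have intA : leb.-integrable `]0, pi[ (EFin \o (\1_A : R -> R)).
  apply: (@integrableS _ _ _ leb setT) => //; exact: integrable_indic_itv.
have intB : leb.-integrable `]0, pi[ (EFin \o (\1_B : R -> R)).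
  apply: (@integrableS _ _ _ leb setT) => //; exact: integrable_indic_itv.
have lA : leb A = (delta * pi)%:E.
  by rewrite /A lebesgue_measure_itv/= lte_fin dp0 oppr0 adde0.
have lB : leb B = (delta * pi)%:E.
  rewrite /B lebesgue_measure_itv/= lte_fin ltrBlDr ltrDl dp0 -EFinB.
  by congr (_%:E); ring.
have iA : Rintegral leb `]0, pi[ (\1_A : R -> R) = delta * pi.
  by rewrite /Rintegral integral_indic// (setIidl subA); have := congr1 fine lA.
have iB : Rintegral leb `]0, pi[ (\1_B : R -> R) = delta * pi.
  by rewrite /Rintegral integral_indic// (setIidl subB); have := congr1 fine lB.
have lI : leb `]0, pi[%classic = pi%:E.
  by rewrite lebesgue_measure_itv/= lte_fin pp oppr0 adde0.
have iE : Rintegral leb `]0, pi[ (fun=> eps) = eps * pi.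
  by rewrite Rintegral_cst//; congr (_ * _); exact: (congr1 fine lI).
have icos : leb.-integrable `]0, pi[
    (EFin \o (fun x => boundary_fun x * cos (1%:R * x))).
  apply: monotone_itv_integrable; [exact: boundary_fun_nd|exact: boundary_fun_le1|].
  exact: continuous_cos_nat.
have bound : `|Rintegral leb `]0, pi[ (fun x => boundary_fun x * cos (1%:R * x))| <=
    eps * pi + delta * pi + delta * pi.
  apply: le_trans; first exact: le_normr_Rintegral.
  apply: le_trans (_ : Rintegral leb `]0, pi[ (fun x => (eps + \1_A x) + \1_B x) <= _).
    apply: le_Rintegral => //.
    - by have := integrable_norm icos; apply: eq_integrable.
    - by apply: integrable_add => //; apply: integrable_add.
    - move=> x /=; rewrite in_itv/= => /andP[x0 x1].
      have iA0 : 0 <= (\1_A x : R) by rewrite indicE ler0n.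
      have iB0 : 0 <= (\1_B x : R) by rewrite indicE ler0n.
      rewrite normrM; apply: le_trans (_ : `|boundary_fun x| <= _).
        by rewrite ler_piMr// ler_norml cos_geN1 cos_le1.
      have b1 := boundary_fun_le1 x.
      have [xA|xA] := leP x (delta * pi).
        have Ax : A x by rewrite /A/= in_itv/= x0.
        have -> : \1_A x = 1 :> R by rewrite indicE mem_set.
        by apply: le_trans b1 _; rewrite addrAC lerDr addr_ge0.
      have [xB|xB] := leP (pi - delta * pi) x.
        have Bx : B x by rewrite /B/= in_itv/= xB.
        have -> : \1_B x = 1 :> R by rewrite indicE mem_set.
        by apply: le_trans b1 _; rewrite lerDr addr_ge0.
      suff h : `|boundary_fun x| <= eps.
        by apply: le_trans h _; rewrite -addrA lerDl addr_ge0.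
      rewrite /boundary_fun [x <= 0]leNgt x0/= [pi <= x]leNgt x1/=; apply: quantile_mid.
      rewrite ltr_pdivlMr// xA/= ler_pdivrMr//; lra.
  rewrite !RintegralD//; last by apply: integrable_add.
  by rewrite iA iB iE.
have c0 : 0 <= 2 / pi :> R by rewrite divr_ge0// ltW.
rewrite /cos_coef normrM (ger0_norm c0).
apply: le_trans (ler_wpM2l c0 bound) _.
have -> : 2 / pi * (eps * pi + delta * pi + delta * pi) = 2 * eps + 4 * delta by field; lra.
by [].
Qed.

Lemma gross_domain_misses : 2 * eps + 4 * delta <= 64^-1 ->
  exists w : R[i], [/\ `|Re w| <= 2^-1, `|Im w| <= 2^-1 & ~ gross_domain mu w].
Proof.
move=> small.
have [w [w1 w2 hw]] := cos_series_misses boundary_fun_nd boundary_fun_le1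
  (le_trans cos_coef1_le small).
exists w; split => // -[z]; rewrite /unit_disc/= normr_normc -[1]/(1%:C) ltcR => z1.
move=> E; apply: (hw z z1); rewrite -E /cos_series /gross_map.
suff -> : (fun N => \sum_(1 <= n < N) ((gross_coef mu n)%:C * z ^+ n) : R[i]^o) =
  (fun N => \sum_(1 <= n < N) ((cos_coef boundary_fun n)%:C * z ^+ n) : R[i]^o) by [].
by apply/funext => N; apply: eq_bigr => n _; rewrite gross_coefE.
Qed.

End Quantile.

(** * The square with two horizontal slits *)

Section SlitSquare.
Variable (R : realType) (h : R).
Local Notation Re := (@complex.Re R).
Local Notation Im := (@complex.Im R).
Hypothesis h01 : 0 < h < 1.

Definition slit_square : set R[i]^o := [set z |
  [/\ `|Re z| < 1, `|Im z| < 1 & `|Im z| != h \/ 2^-1 < Re z]].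

(** A Lipschitz function that is positive exactly on the slit square. It turns
    the exit from the domain into the first time at which a real process is
    nonpositive. *)
Definition depth (x y : R) : R :=
  Num.min (Num.min (1 - `|x|) (1 - `|y|)) (Num.max `| `|y| - h| (x - 2^-1)).

Lemma depth_gt0 z : (0 < depth (Re z) (Im z)) <-> slit_square z.
Proof.
rewrite /depth !lt_min lt_max !subr_gt0 normr_gt0 subr_eq0; split.
  by move=> /andP[/andP[h1 h2] /orP h3]; split.
by move=> [h1 h2 h3]; rewrite h1 h2; apply/orP.
Qed.

Lemma dist_minr (a b c d M : R) : `|a - c| <= M -> `|b - d| <= M ->
  `|Num.min a b - Num.min c d| <= M.
Proof.
rewrite !ler_norml => /andP[? ?] /andP[? ?].
by have [?|?] := leP a b; have [?|?] := leP c d; apply/andP; split; lra.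
Qed.

Lemma dist_maxr (a b c d M : R) : `|a - c| <= M -> `|b - d| <= M ->
  `|Num.max a b - Num.max c d| <= M.
Proof.
rewrite !ler_norml => /andP[? ?] /andP[? ?].
by have [?|?] := leP a b; have [?|?] := leP c d; apply/andP; split; lra.
Qed.

Lemma depth_lipschitz (x y x' y' : R) :
  `|depth x y - depth x' y'| <= `|x - x'| + `|y - y'|.
Proof.
have hx := ler_dist_dist x x'. have hy := ler_dist_dist y y'.
have px := normr_ge0 (x - x'). have py := normr_ge0 (y - y').
apply: dist_minr; first apply: dist_minr.
- have -> : 1 - `|x| - (1 - `|x'|) = `|x'| - `|x| by ring.
  by rewrite distrC; lra.
- have -> : 1 - `|y| - (1 - `|y'|) = `|y'| - `|y| by ring.
  by rewrite distrC; lra.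
apply: dist_maxr.
  apply: le_trans (ler_dist_dist _ _) _.
  have -> : `|y| - h - (`|y'| - h) = `|y| - `|y'| by ring.
  lra.
have -> : x - 2^-1 - (x' - 2^-1) = x - x' by ring.
lra.
Qed.

Lemma slit_square_open : open slit_square.
Proof.
rewrite openE => z /depth_gt0 dz.
apply/nbhs_ballP; exists (depth (Re z) (Im z) / 2)%:C.
  by rewrite /= ltcR divr_gt0.
move=> w; rewrite -ball_normE /= normr_normc ltcR => zw.
apply/depth_gt0.
have := depth_lipschitz (Re z) (Im z) (Re w) (Im w).
rewrite -ReB -ImB => /(le_trans (ler_norm _)).
have := ler_Re_normc (z - w); have := ler_Im_normc (z - w); lra.
Qed.

Lemma slit_square0 : slit_square 0.
Proof. by case/andP: h01 => ? ?; split; rewrite /= ?normr0 ?ltr01//; left; rewrite lt_eqF. Qed.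

Lemma slit_square_bounded : bounded_set slit_square.
Proof.
exists 2; split; first exact: realn.
move=> M M2 z [z1 z2 _]; apply: le_trans (ltW M2).
have -> : (2 : R[i]) = (2 : R)%:C by rewrite rmorph_nat.
rewrite normr_normc lecR.
by apply: le_trans (normc_le_parts _) _; lra.
Qed.

Lemma continuous_path_complex (u v : R -> R) : continuous u -> continuous v ->
  continuous (fun t => u t +i* v t : R[i]^o).
Proof.
move=> cu cv t; apply/cvgrPdist_le => e e0.
have [E e0'] : e = (Re e)%:C /\ 0 < Re e.
  by move: e0; rewrite ltcE/=; case: e => x y /= /andP[/eqP -> ?].
have e2 : 0 < Re e / 2 by rewrite divr_gt0.
have /cvgrPdist_le/(_ _ e2) hu := cu t.
have /cvgrPdist_le/(_ _ e2) hv := cv t.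
near=> s; rewrite E normr_normc lecR; apply: le_trans (normc_le_parts _) _.
rewrite /=.
have : `|u t - u s| <= Re e / 2 by near: s.
have : `|v t - v s| <= Re e / 2 by near: s.
lra.
Unshelve. all: by end_near.
Qed.

(** From any point one reaches the abscissa 3/4, to the right of the slits,
    along a horizontal segment, and all these segments meet the same vertical
    segment. *)
Lemma slit_square_connected : connected slit_square.
Proof.
pose V : set R[i]^o := [set (3 / 4) +i* y | y in `]-1, 1[%classic].
pose A (z : R[i]) : set R[i]^o :=
  [set ((1 - t) * Re z + t * (3 / 4)) +i* Im z | t in `[0, 1]%classic].
have cV : connected V.
  apply: connected_continuous_connected.
    by apply/connected_intervalP; exact: interval_is_interval.
  apply: continuous_subspaceT; apply: continuous_path_complex => t.
    exact: cst_continuous.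
  exact: cvg_id.
have cA z : connected (A z).
  apply: connected_continuous_connected; first exact: segment_connected.
  apply: continuous_subspaceT; apply: continuous_path_complex => t; last exact: cst_continuous.
  apply: cvgD; apply: cvgM; try exact: cvg_cst; try exact: cvg_id.
  by apply: cvgB; [exact: cvg_cst|exact: cvg_id].
have -> : slit_square = \bigcup_(z in slit_square) (A z `|` V).
  apply/seteqP; split=> [z Uz|w [z [z1 z2 z3]]].
    exists z => //; left; exists 0; first by rewrite /= in_itv/= lexx ler01.
    by rewrite subr0 mul1r mul0r addr0; case: (z).
  move=> [[t]|[y]] /=; rewrite in_itv/= => /andP[t0 t1] <-.
    move: z1; rewrite ltr_norml => /andP[za zb].
    split => //=.
      by rewrite ltr_norml; apply/andP; split; nra.
    by case: z3 => z3; [left|right; nra].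
  split => /=; first by rewrite ger0_norm; lra.
    by rewrite ltr_norml t0.
  by right; lra.
apply: bigcup_connected.
  exists ((3 / 4) +i* 0) => z Uz; right; exists 0 => //.
  by rewrite /= in_itv/=; apply/andP; split; lra.
move=> z [z1 z2 z3]; apply: connectedU => //.
exists ((3 / 4) +i* Im z); split.
  exists 1; first by rewrite /= in_itv/= lexx ler01.
  by rewrite subrr mul0r mul1r add0r.
by exists (Im z) => //; rewrite /= in_itv/= -ltr_norml.
Qed.

(** At these abscissas the vertical section is the interval (-1, 1) minus the
    points h and -h. *)
Lemma slit_square_vertical_length (x : R) : `|x| <= 2^-1 ->
  vertical_length slit_square x = 2%:E.
Proof.
move=> hx; case/andP: h01 => h0 h1.
have hx' : x <= 2^-1 by exact: le_trans (ler_norm x) hx.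
pose A : set R := `]-1, (- h)[%classic. pose B : set R := `](- h), h[%classic.
pose C : set R := `]h, 1[%classic.
have mA : measurable A by exact: measurable_itv.
have mB : measurable B by exact: measurable_itv.
have mC : measurable C by exact: measurable_itv.
have lA : lebesgue_measure A = (1 - h)%:E.
  rewrite /A lebesgue_measure_itv/= lte_fin ltrN2 h1 -EFinB.
  by congr (_%:E); ring.
have lB : lebesgue_measure B = (h + h)%:E.
  rewrite /B lebesgue_measure_itv/= lte_fin -EFinB.
  by rewrite (_ : _ < _ = true); [congr (_%:E); ring|apply/idP; lra].
have lC : lebesgue_measure C = (1 - h)%:E.
  by rewrite /C lebesgue_measure_itv/= lte_fin h1 -EFinB.
rewrite /vertical_length (_ : [set y | _] = (A `|` B) `|` C).
  rewrite measureU//=; last 2 first.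
  - exact: measurableU.
  - apply/seteqP; split => // y [[|]]; rewrite /A /B /C /= !in_itv/=; lra.
  rewrite measureU//=; last first.
    by apply/seteqP; split => // y []; rewrite /A /B /= !in_itv/=; lra.
  transitivity ((1 - h)%:E + (h + h)%:E + (1 - h)%:E)%E.
    by congr (_ + _ + _)%E.
  by rewrite -!EFinD; congr (_%:E); ring.
apply/seteqP; split => y.
  move=> [/= y1 y2 [y3|]]; last lra.
  move: y2; rewrite ltr_norml => /andP[ya yb].
  have [yh|yh|yh] := ltgtP y (- h); rewrite /A /B /C /= !in_itv/=.
  - by left; left; rewrite ya.
  - have [yh'|yh'|yh'] := ltgtP y h; first by left; right; rewrite yh.
      by right; rewrite yb.
    by move: y3; rewrite yh' ger0_norm ?eqxx// ltW.
  - by move: y3; rewrite yh normrN ger0_norm ?eqxx// ltW.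
rewrite /A /B /C /= !in_itv/= => H; split => /=; first lra.
  by rewrite ltr_norml; apply/andP; case: H => [[|]|] /andP[? ?]; split; lra.
left; apply/eqP => yh; case: H => [[|]|] /andP[? ?].
- by rewrite ltr0_norm in yh; lra.
- have : `|y| < h by rewrite ltr_norml; apply/andP; split.
  by rewrite yh ltxx.
- by rewrite gtr0_norm in yh; lra.
Qed.

Lemma steiner_slit_square (w : R[i]) : `|Re w| <= 2^-1 -> `|Im w| <= 2^-1 ->
  steiner_symmetrization slit_square w.
Proof.
move=> w1 w2; case/andP: h01 => h0 h1.
exists ((Re w) +i* 0); first by split => /=; rewrite ?normr0; [lra|lra|left; rewrite lt_eqF].
exists (Im w / 2).
  rewrite /= in_itv/=; move: w2; rewrite ler_norml => /andP[? ?].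
  by apply/andP; split; lra.
rewrite /= slit_square_vertical_length//= mulfVK// ?pnatr_eq0//.
by case: (w).
Qed.

End SlitSquare.

(** * Gaussian estimates *)

Section NormalEstimates.
Variable (R : realType).
Local Notation leb := (@lebesgue_measure R).

Lemma measurable_normr_gt (c : R) : measurable [set x : R | c < `|x|].
Proof.
have -> : [set x : R | c < `|x|] = `]c, +oo[%classic `|` `]-oo, (- c)[%classic.
  apply/seteqP; split => x /=; rewrite !in_itv/= andbT ltr_normr ltrNr.
    by move=> /orP.
  by move=> H; apply/orP.
by apply: measurableU; exact: measurable_itv.
Qed.

Lemma measurable_normr_lt (c : R) : measurable [set x : R | `|x| < c].
Proof.
have -> : [set x : R | `|x| < c] = `](- c), c[%classic.
  by apply/seteqP; split => x /=; rewrite in_itv/= ltr_norml.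
exact: measurable_itv.
Qed.

(** Comparison with the centred normal law of twice the standard deviation,
    whose total mass is 1. *)
Lemma normal_prob_scale (s K : R) (A : set R) : measurable A -> 0 <= K ->
  0 < s -> (forall x, A x -> normal_pdf 0 s x <= K * normal_pdf 0 (2 * s) x) ->
  (normal_prob 0%R s A <= K%:E)%E.
Proof.
move=> mA K0 s0 H.
have m1 : measurable_fun A (fun x => (normal_pdf 0 s x)%:E).
  by apply/measurable_EFinP; apply: measurable_funTS; exact: measurable_normal_pdf.
have m2 : measurable_fun setT (fun x => (normal_pdf 0 (2 * s) x)%:E).
  by apply/measurable_EFinP; exact: measurable_normal_pdf.
apply: (@le_trans _ _ (\int[leb]_(x in A) (K%:E * (normal_pdf 0 (2 * s) x)%:E))%E).
  apply: ge0_le_integral => //.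
  - by move=> x _; rewrite lee_fin normal_pdf_ge0.
  - by apply: measurable_funeM; apply: measurable_funTS.
have m3 : measurable_fun A (fun x => (normal_pdf 0 (2 * s) x)%:E).
  exact: measurable_funTS.
have p3 x : A x -> (0 <= (normal_pdf 0 (2 * s) x)%:E)%E.
  by move=> _; rewrite lee_fin normal_pdf_ge0.
rewrite ge0_integralZl_EFin//.
rewrite -[leRHS]mule1; apply: lee_wpmul2l; first by rewrite lee_fin.
rewrite -(@integral_normal_pdf R 0 (2 * s)).
by apply: ge0_subset_integral => // x _; rewrite lee_fin normal_pdf_ge0.
Qed.

(** For |x| > c the density with deviation s is at most
    2 exp (- 3 c^2 / (8 s^2)) times the density with deviation 2 s, and
    exp (- v) <= 4 / v^2. The fourth power of s / c suffices for the union
    bound over dyadic grids. *)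
Lemma normal_tail (s c : R) : 0 < s -> 0 < c ->
  (normal_prob 0%R s [set x : R | (c < `|x|)%R] <= (64 * (s ^+ 2) ^+ 2 / c ^+ 4)%:E)%E.
Proof.
move=> s0 c0.
have mA := measurable_normr_gt c.
have K0 : 0 <= 64 * (s ^+ 2) ^+ 2 / c ^+ 4 by apply: divr_ge0; [rewrite mulr_ge0 ?sqr_ge0|rewrite exprn_ge0// ltW].
apply: normal_prob_scale => // x /= cx.
rewrite !normal_pdfE ?gt_eqF ?mulr_gt0// /normal_peak /normal_fun !subr0.
have -> : (2 * s) ^+ 2 * pi *+ 2 = 2 ^+ 2 * (s ^+ 2 * pi *+ 2).
  by rewrite exprMn -mulrA -mulrnAr.
rewrite sqrtrM ?sqr_ge0// sqrtr_sqr ger0_norm// [(2 * _)^-1]invfM.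
set p := (Num.sqrt _)^-1; have p0 : 0 <= p by rewrite invr_ge0 sqrtr_ge0.
have ->: 64 * (s ^+ 2) ^+ 2 / c ^+ 4 * (2^-1 * p * expR (- x ^+ 2 / ((2 * s) ^+ 2 *+ 2))) =
  p * (32 * (s ^+ 2) ^+ 2 / c ^+ 4 * expR (- x ^+ 2 / ((2 * s) ^+ 2 *+ 2))) by field; rewrite gt_eqF.
apply: ler_wpM2l => //.
pose u := 3 * x ^+ 2 / (8 * s ^+ 2).
have s2 : 0 < s ^+ 2 by rewrite exprn_gt0.
have c2 : 0 < c ^+ 2 by rewrite exprn_gt0.
have -> : - x ^+ 2 / (s ^+ 2 *+ 2) = - x ^+ 2 / ((2 * s) ^+ 2 *+ 2) + - u.
  by rewrite /u -[s ^+ 2 *+ 2]mulr_natr -[(2 * s) ^+ 2 *+ 2]mulr_natr; field; rewrite gt_eqF.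
rewrite expRD mulrC; apply: ler_wpM2r; first exact: expR_ge0.
have x2 : c ^+ 2 <= x ^+ 2.
  by rewrite -(real_normK (num_real x)); apply: lerXn2r; [rewrite nnegrE ltW|rewrite nnegrE|exact: ltW].
pose v := 3 * c ^+ 2 / (8 * s ^+ 2).
have vu : v <= u by rewrite /u /v ler_pM2r ?invr_gt0 ?mulr_gt0// ler_pM2l.
have v0 : 0 < v by rewrite /v divr_gt0 ?mulr_gt0.
apply: (@le_trans _ _ (expR (- v))); first by rewrite ler_expR lerN2.
have ev : v ^+ 2 / 4 <= expR v.
  have h := expR_ge1Dx (v / 2).
  have -> : expR v = expR (v / 2) ^+ 2 by rewrite -expRM_natl -mulr_natl; congr expR; field.
  nra.
rewrite expRN; apply: (@le_trans _ _ (v ^+ 2 / 4)^-1).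
  by rewrite lef_pV2// posrE ?expR_gt0// divr_gt0// exprn_gt0.
have -> : (v ^+ 2 / 4)^-1 = (256 / 9) * (s ^+ 2) ^+ 2 / c ^+ 4.
  by rewrite /v; field; rewrite !gt_eqF.
rewrite ler_pM2r ?invr_gt0 ?exprn_gt0// ler_pM2r ?exprn_gt0//; lra.
Qed.

Lemma normal_center (s h : R) : 0 < s -> 0 < h ->
  (normal_prob 0%R s [set x : R | (`|x| < h)%R] <= (2 * h / s)%:E)%E.
Proof.
move=> s0 h0.
pose I : set R := `](- h), h[%classic.
have -> : [set x : R | `|x| < h] = I.
  by apply/seteqP; split => x; rewrite /I /= in_itv/= ltr_norml.
have sn0 : s != 0 by rewrite gt_eqF.
have mI : measurable I by exact: measurable_itv.
have lI : leb I = (h + h)%:E.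
  rewrite /I lebesgue_measure_itv/= lte_fin (_ : - h < h = true); last by apply/idP; lra.
  by rewrite -EFinB opprK.
have m1 : measurable_fun I (fun x => (normal_pdf 0 s x)%:E).
  by apply/measurable_EFinP; apply: measurable_funTS; exact: measurable_normal_pdf.
apply: (@le_trans _ _ (\int[leb]_(x in I) (s^-1)%R%:E)%E).
  apply: ge0_le_integral => //.
  - by move=> x _; rewrite lee_fin normal_pdf_ge0.
  - move=> x _; rewrite lee_fin; apply: le_trans (normal_pdf_ub _ _ sn0) _.
    have pp := pi_ge2 R; have s2 : 0 < s ^+ 2 by rewrite exprn_gt0.
    rewrite /normal_peak lef_pV2 ?posrE//; last first.
      by rewrite sqrtr_gt0 mulrn_wgt0// mulr_gt0 ?pi_gt0.
    rewrite -[leLHS](ger0_norm (ltW s0)) -sqrtr_sqr ler_wsqrtr// mulr2n; nra.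
rewrite integral_cst//; have := lI; rewrite /= => ->.
by rewrite -EFinM lee_fin; have -> : s^-1 * (h + h) = 2 * h / s by ring.
Qed.

End NormalEstimates.

(** * Small oscillation of Brownian paths *)

Section WithinContinuity.
Variable (R : realType).

Lemma within_continuous_eps (f : R -> R) (s e : R) :
  {within `[0, +oo[, continuous f} -> 0 <= s -> 0 < e ->
  exists2 d, 0 < d & forall u, 0 <= u -> `|u - s| < d -> `|f u - f s| < e.
Proof.
move=> /subspace_continuousP H s0 e0.
have As : `[0, +oo[%classic s by rewrite /= in_itv/= andbT.
have /cvgrPdist_lt/(_ _ e0) := H s As.
rewrite /prop_near1 /within /= => /nbhs_ballP[d d0 hd].
exists d => // u u0 us; rewrite distrC; apply: hd.
  by rewrite /ball/= distrC.
by rewrite in_itv/= andbT.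
Qed.

End WithinContinuity.

Section Chaining.
Context (R : realType) d (T : measurableType d) (P : probability T R).
Variable X : R -> T -> R.
Hypothesis bmX : is_brownian_motion P X.

Lemma bm_measurable t : 0 <= t -> measurable_fun setT (X t).
Proof. by case: bmX => + _ _ _ _; apply. Qed.

Lemma bm_increment_measurable s t : 0 <= s -> 0 <= t ->
  measurable_fun setT (fun w => X t w - X s w).
Proof. by move=> s0 t0; apply: measurable_funB; exact: bm_measurable. Qed.

Lemma bm_increment_event s t c : 0 <= s -> 0 <= t ->
  measurable [set w | c < `|X t w - X s w|].
Proof.
move=> s0 t0; rewrite -[X in measurable X]setTI.
exact: (bm_increment_measurable s0 t0 measurableT (measurable_normr_gt c)).
Qed.

Lemma bm_increment_tail s t c : 0 <= s -> s < t -> 0 < c ->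
  (P [set w | (c < `|X t w - X s w|)%R] <= (64 * (t - s) ^+ 2 / c ^+ 4)%:E)%E.
Proof.
move=> s0 st c0; case: bmX => _ _ _ _ law.
have mA := measurable_normr_gt c.
have := law s t s0 st _ mA; rewrite /pushforward => ->.
have ts : 0 < t - s by rewrite subr_gt0.
have := @normal_tail R (Num.sqrt (t - s)) c; rewrite sqrtr_gt0 => /(_ ts c0).
by rewrite sqr_sqrtr// ltW.
Qed.

Lemma bm_center t h : 0 < t -> 0 < h ->
  (P [set w | (`|X t w| < h)%R] <= (2 * h / Num.sqrt t)%:E)%E.
Proof.
move=> t0 h0; case: bmX => _ X0 _ _ law.
have mA := measurable_normr_lt h.
have := law 0 t (lexx _) t0 _ mA; rewrite /pushforward subr0.
have -> : (fun w => X t w - X 0 w) @^-1` [set x | `|x| < h] = [set w | `|X t w| < h].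
  by apply/seteqP; split => w /=; rewrite X0 subr0.
move=> ->; apply: normal_center => //; rewrite sqrtr_gt0//.
Qed.

Variables (t c : R).
Hypotheses (t0 : 0 < t) (c0 : 0 < c).
Let q : R := 9 / 10.
Let grid k j : R := j%:R * (t / 2 ^+ k).

(** The thresholds c * (9/10)^k decrease slowly enough for the probabilities of
    a jump at level k to be summable, and add up to 10 c. *)
Definition jump k j : set T :=
  [set w | c * q ^+ k < `|X (grid k j.+1) w - X (grid k j) w|].

Definition big_jump k : set T := \big[setU/set0]_(j < 2 ^ k) jump k j.

Definition some_big_jump : set T := \bigcup_k big_jump k.

Let p2 k : 0 < 2 ^+ k :> R. Proof. by rewrite exprn_gt0. Qed.
Let grid_ge0 k j : 0 <= grid k j.
Proof. by rewrite /grid mulr_ge0// divr_ge0// ltW. Qed.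

Lemma big_jump_measurable k : measurable (big_jump k).
Proof. by apply: bigsetU_measurable => j _; exact: bm_increment_event. Qed.

Lemma some_big_jump_measurable : measurable some_big_jump.
Proof. by apply: bigcup_measurable => k _; exact: big_jump_measurable. Qed.

(** There are 2^k increments, of variance t / 2^k each, so the fourth-power tail
    gives a geometric bound of ratio 1 / (2 (9/10)^4) < 4/5. *)
Lemma big_jump_le k :
  (P (big_jump k) <= (64 * t ^+ 2 / c ^+ 4 * (4 / 5) ^+ k)%:E)%E.
Proof.
have one j : (P (jump k j) <= (64 * (t / 2 ^+ k) ^+ 2 / (c * q ^+ k) ^+ 4)%:E)%E.
  have E : grid k j.+1 - grid k j = t / 2 ^+ k by rewrite /grid -natr1; ring.
  have h1 : grid k j < grid k j.+1 by rewrite -subr_gt0 E divr_gt0.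
  have h2 : 0 < c * q ^+ k by rewrite mulr_gt0// exprn_gt0// /q; lra.
  by have := bm_increment_tail (grid_ge0 k j) h1 h2; rewrite E.
set b := 64 * _ / _ in one.
have q0 : 0 < q by rewrite /q; lra.
have many n : (P (\big[setU/set0]_(j < n) jump k j) <= (n%:R * b)%:E)%E.
  elim: n => [|n IH]; first by rewrite big_ord0 measure0 mul0r.
  rewrite big_ord_recr/=; apply: le_trans (measureU2 _ _ _) _.
  - by apply: bigsetU_measurable => j _; exact: bm_increment_event.
  - exact: bm_increment_event.
  by rewrite -natr1 mulrDl mul1r EFinD; exact: leeD IH (one n).
apply: le_trans (many _) _; rewrite lee_fin natrX /b.
have ident (A r : R) : 0 < A -> 0 < r ->
    A * (64 * (t / A) ^+ 2 / (c * r) ^+ 4) = 64 * t ^+ 2 / c ^+ 4 * (A * r ^+ 4)^-1.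
  by move=> A0 r0; field; rewrite !gt_eqF.
rewrite ident ?exprn_gt0//.
have -> : (2 ^+ k * (q ^+ k) ^+ 4)^-1 = ((2 * q ^+ 4)^-1) ^+ k.
  by rewrite exprVn [in RHS]exprMn exprAC.
apply: ler_wpM2l.
  by apply: divr_ge0; [rewrite mulr_ge0 ?sqr_ge0|rewrite exprn_ge0// ltW].
apply: lerXn2r; rewrite ?nnegrE ?invr_ge0 ?mulr_ge0 ?exprn_ge0 ?(ltW q0)//.
rewrite -[leRHS]invrK lef_pV2 ?posrE ?invr_gt0 ?mulr_gt0 ?exprn_gt0//; rewrite /q; lra.
Qed.

Lemma some_big_jump_le : (P some_big_jump <= (320 * t ^+ 2 / c ^+ 4)%:E)%E.
Proof.
(* The factor 5 is the sum of the geometric series of ratio 4/5. *)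
set b := 64 * t ^+ 2 / c ^+ 4.
have b0 : 0 <= b by apply: divr_ge0; [rewrite mulr_ge0 ?sqr_ge0|rewrite exprn_ge0// ltW].
have partial n : (P (\big[setU/set0]_(k < n) big_jump k) <= (5 * b)%:E)%E.
  suff : (P (\big[setU/set0]_(k < n) big_jump k) <= (5 * b * (1 - (4 / 5) ^+ n))%:E)%E.
    move=> h; apply: le_trans h _; rewrite lee_fin.
    have : 0 <= 5 * b * (4 / 5) ^+ n by rewrite mulr_ge0 ?exprn_ge0// mulr_ge0.
    by rewrite mulrBr mulr1; lra.
  elim: n => [|n IH]; first by rewrite big_ord0 measure0 expr0 subrr mulr0.
  rewrite big_ord_recr/=; apply: le_trans (measureU2 _ _ _) _.
  - by apply: bigsetU_measurable => j _; exact: big_jump_measurable.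
  - exact: big_jump_measurable.
  apply: le_trans (leeD IH (big_jump_le n)) _.
  by rewrite -EFinD lee_fin [_ ^+ n.+1]exprS -/b; move: ((4 / 5) ^+ n) => x; nra.
have -> : 320 * t ^+ 2 / c ^+ 4 = 5 * b by rewrite /b; ring.
have E : some_big_jump = \bigcup_n (\big[setU/set0]_(k < n.+1) big_jump k).
  rewrite /some_big_jump; apply/seteqP; split => w.
    move=> [k _ wk]; exists k => //; rewrite big_ord_recr/=; by right.
  by move=> [n _]; rewrite -bigcup_mkord => -[k _ wk]; exists k.
have mono : nondecreasing_seq (fun n => \big[setU/set0]_(k < n.+1) big_jump k).
  move=> m n mn; apply/subsetPset; rewrite -!bigcup_mkord => w [k /= km wk].
  by exists k => //=; exact: leq_trans km _.
have mB n : measurable (\big[setU/set0]_(k < n.+1) big_jump k).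
  by apply: bigsetU_measurable => j _; exact: big_jump_measurable.
have := nondecreasing_cvg_mu mB _ mono.
rewrite -E => /(_ R P some_big_jump_measurable) cv.
rewrite -(cvg_lim _ cv)//; apply: lime_le; first by apply/cvg_ex; eexists; exact: cv.
by apply: nearW => n; exact: partial.
Qed.

(** A point of the grid of level k + 1 is a point of the grid of level k or the
    successor of one. *)
Lemma grid_bound w : ~ some_big_jump w -> forall k j, (j <= 2 ^ k)%N ->
  `|X (grid k j) w| <= \sum_(i < k.+1) c * q ^+ i.
Proof.
move=> nj; have step k j : (j < 2 ^ k)%N ->
    `|X (grid k j.+1) w - X (grid k j) w| <= c * q ^+ k.
  move=> jk; rewrite leNgt; apply/negP => big; apply: nj; exists k => //.
  by rewrite /big_jump -bigcup_mkord; exists j.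
case: bmX => _ X0 _ _ _.
elim=> [|k IH] j jk.
  rewrite big_ord_recr/= big_ord0 add0r.
  case: j jk => [|[|//]] _.
    by rewrite /grid mul0r X0 normr0 expr0 mulr1 ltW.
  by have := step 0%N 0%N isT; rewrite /grid mul0r X0 subr0.
rewrite big_ord_recr/=.
have half i : grid k.+1 i.*2 = grid k i.
  by rewrite /grid -muln2 natrM exprS; field; rewrite gt_eqF.
have cq : 0 <= c * q ^+ k.+1 by rewrite mulr_ge0 ?exprn_ge0 ?ltW// /q; lra.
have jE := odd_double_half j.
case: (boolP (odd j)) jE => [oj|ej] jE; last first.
  rewrite add0n in jE; rewrite -jE half.
  have h : (j./2 <= 2 ^ k)%N by rewrite -leq_double jE -mul2n -expnS.
  by have := IH _ h; lra.
have h' : (j./2.*2 < 2 ^ k.+1)%N.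
  by apply: leq_trans jk; rewrite -[leqRHS]jE add1n.
have h : (j./2 < 2 ^ k)%N by move: h'; rewrite expnS mul2n ltn_double.
have := step k.+1 j./2.*2 h'; rewrite half.
have -> : j./2.*2.+1 = j by rewrite -[RHS]jE add1n.
have := IH _ (ltnW h).
have := ler_normD (X (grid k.+1 j) w - X (grid k j./2) w) (X (grid k j./2) w).
rewrite subrK; lra.
Qed.

Lemma path_bound w : ~ some_big_jump w -> forall s, 0 <= s <= t -> `|X s w| <= 10 * c.
Proof.
move=> nj s /andP[s0 st].
have geo k : \sum_(i < k) c * q ^+ i <= 10 * c.
  suff -> : \sum_(i < k) c * q ^+ i = 10 * c * (1 - q ^+ k).
    rewrite ler_piMr ?mulr_ge0 ?(ltW c0)// gerBl exprn_ge0// /q; lra.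
  elim: k => [|k IH]; first by rewrite big_ord0 expr0 subrr mulr0.
  by rewrite big_ord_recr/= IH exprS /q; field.
rewrite leNgt; apply/negP => big.
have e0 : 0 < `|X s w| - 10 * c by rewrite subr_gt0.
case: bmX => _ _ cX _ _.
have [r r0 hr] := within_continuous_eps (cX w) s0 e0.
have [k hk] : exists k, t / 2 ^+ k < r.
  have /cvgrPdist_lt/(_ _ r0)[k _ /(_ k (leqnn k))] :
     (fun k => t * (2^-1) ^+ k) @ \oo --> (0 : R).
    rewrite -(mulr0 t); apply: cvgMr; apply: cvg_expr.
    by rewrite ger0_norm ?invr_ge0// invf_lt1// ltr1n.
  rewrite sub0r normrN => h; exists k; apply: le_lt_trans h.
  by rewrite exprVn ler_norm.
(* The grid point of level k just before s. *)
pose y := s / (t / 2 ^+ k).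
have g0 : 0 < t / 2 ^+ k by rewrite divr_gt0.
have y0 : 0 <= y by rewrite divr_ge0// ltW.
have /andP[j1 j2] := truncn_itv y0.
set j := Num.truncn y in j1 j2.
have gj : grid k j <= s by rewrite /grid -ler_pdivlMr.
have gj' : s < grid k j + t / 2 ^+ k.
  have -> : grid k j + t / 2 ^+ k = j.+1%:R * (t / 2 ^+ k) by rewrite /grid -natr1; ring.
  by rewrite -ltr_pdivrMr.
have jk : (j <= 2 ^ k)%N.
  rewrite -(ler_nat R) natrX; apply: le_trans j1 _.
  rewrite /y ler_pdivrMr// mulrC mulfVK ?gt_eqF//.
have := grid_bound nj jk; have := geo k.+1.
have : `|grid k j - s| < r by rewrite distrC ger0_norm ?subr_ge0//; lra.
move=> /(hr _ (grid_ge0 k j)) h1 h2 h3.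
have := ler_normD (X s w - X (grid k j) w) (X (grid k j) w).
by rewrite subrK distrC; lra.
Qed.

End Chaining.

(** * The value of a process at a hitting time *)

Section StoppedValue.
Context (R : realType) d (T : measurableType d).
Variables G X : R -> T -> R.
Hypothesis G_cont : forall w, {within `[0, +oo[, continuous (fun t => G t w)}.
Hypothesis X_cont : forall w, {within `[0, +oo[, continuous (fun t => X t w)}.
Hypothesis G_meas : forall t, 0 <= t -> measurable_fun setT (G t).
Hypothesis X_meas : forall t, 0 <= t -> measurable_fun setT (X t).

Definition hits w : set R := [set t | 0 <= t /\ G t w <= 0].
Definition hitting_time w : R := inf (hits w).
Local Notation tau := hitting_time.

Lemma hits_lbound w : lbound (hits w) 0.
Proof. by move=> t []. Qed.

Lemma hitting_time_ge0 w : 0 <= tau w.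
Proof.
have [ne|/set0P/negP/negPn/eqP e] := pselect (hits w !=set0).
  by apply: lb_le_inf => //; exact: hits_lbound.
by rewrite /tau e inf0.
Qed.

Lemma hitting_time_le w t : hits w t -> tau w <= t.
Proof. by move=> ht; apply: ge_inf => //; exists 0; exact: hits_lbound. Qed.

(** If G were positive at the hitting time, it would stay positive for a
    while. *)
Lemma hits_hitting_time w : hits w !=set0 -> hits w (tau w).
Proof.
move=> ne; split; first exact: hitting_time_ge0.
rewrite leNgt; apply/negP => pos.
have [r r0 hr] := within_continuous_eps (@G_cont w) (hitting_time_ge0 w) pos.
have hi : has_inf (hits w) by split=> //; exists 0; exact: hits_lbound.
have [t [t0 Gt] tr] := inf_adherent r0 hi.
have tt : tau w <= t by exact: hitting_time_le.
have : `|t - tau w| < r by rewrite ger0_norm ?subr_ge0// ltrBlDl.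
move=> /(hr t t0); rewrite ltr_norml => /andP[h _]; lra.
Qed.

Let gridpoint (s : R) (k m : nat) : R := Num.min s (k%:R * (s / m.+1%:R)).

Let gridpoint_itv s k m : 0 <= s -> 0 <= gridpoint s k m <= s.
Proof.
move=> s0; rewrite /gridpoint ge_min lexx/= andbT le_min s0/=.
by rewrite mulr_ge0// divr_ge0.
Qed.

(** By compactness of [0, s], a hit before s is detected by values of G on a
    countable dense set of times. *)
Lemma hit_before_countable (s : R) : 0 <= s ->
  [set w | exists2 t, hits w t & t <= s] =
  \bigcap_n \bigcup_m \bigcup_k [set w | G (gridpoint s k m) w < n.+1%:R^-1].
Proof.
move=> s0; have sge0 := s0; apply/seteqP; split => w.
  move=> [t [t0 Gt] ts] n _.
  have e0 : 0 < n.+1%:R^-1 :> R by rewrite invr_gt0 ltr0n.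
  have [r r0 hr] := within_continuous_eps (@G_cont w) t0 e0.
  have near u : 0 <= u -> `|u - t| < r -> G u w < n.+1%:R^-1.
    move=> u0 /(hr u u0); rewrite ltr_norml ltrBlDr => /andP[_ h].
    by apply: lt_le_trans h _; rewrite gerDl.
  move: s0; rewrite le_eqVlt => /predU1P[s0|s0].
    exists 0%N => //; exists 0%N => //=; apply: near.
      by case/andP: (gridpoint_itv 0 0 sge0).
    have t00 : t = 0 by apply/le_anti; rewrite t0 andbT s0.
    by rewrite /gridpoint -s0 t00 mul0r minxx subrr normr0.
  pose m := Num.truncn (s / r).
  have gm : s / m.+1%:R < r.
    have : s / r < m.+1%:R by exact: truncnS_gt.
    by rewrite ltr_pdivrMr// => h; rewrite ltr_pdivrMr ?ltr0n// mulrC.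
  have g0 : 0 < s / m.+1%:R by rewrite divr_gt0// ltr0n.
  have y0 : 0 <= t / (s / m.+1%:R) by rewrite divr_ge0// ltW.
  have /andP[k1 k2] := truncn_itv y0.
  set k := Num.truncn _ in k1 k2.
  exists m => //; exists k => //=; apply: near.
    by case/andP: (gridpoint_itv k m sge0).
  rewrite ler_pdivlMr// in k1; rewrite ltr_pdivrMr// in k2.
  rewrite /gridpoint min_r; last exact: le_trans k1 ts.
  rewrite -natr1 mulrDl mul1r in k2.
  rewrite distrC ger0_norm ?subr_ge0//; move: k1 k2 gm.
  by move: (s / m.+1%:R) => g; lra.
move=> H.
have cG : {within `[0, s], continuous (fun t => G t w)}.
  apply: continuous_subspaceW (@G_cont w).
  by move=> t /=; rewrite !in_itv/= andbT => /andP[].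
have [c] := EVT_min s0 cG.
rewrite in_itv/= => /andP[c0 cs] hc.
exists c => //; split => //; rewrite leNgt; apply/negP => pos.
have := truncnS_gt (G c w)^-1; set n := Num.truncn _ => hn.
have [m _ [k _ /= h]] := H n I.
have := hc (gridpoint s k m); rewrite in_itv/= gridpoint_itv// => /(_ isT) h2.
have : n.+1%:R^-1 < G c w.
  by rewrite -[ltRHS]invrK ltf_pV2// posrE ?ltr0n// invr_gt0.
by move=> h3; have := lt_trans h3 (le_lt_trans h2 h); rewrite ltxx.
Qed.

Lemma hit_before_measurable (s : R) : 0 <= s ->
  measurable [set w | exists2 t, hits w t & t <= s].
Proof.
move=> s0; rewrite hit_before_countable//.
apply: bigcap_measurable => // n _; apply: bigcup_measurable => m _.
apply: bigcup_measurable => k _.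
have -> : [set w | G (gridpoint s k m) w < n.+1%:R^-1] =
    G (gridpoint s k m) @^-1` `]-oo, n.+1%:R^-1[%classic.
  by apply/seteqP; split => w /=; rewrite in_itv.
have /andP[g0 _] := gridpoint_itv k m s0.
by rewrite -[X in measurable X]setTI; apply: (G_meas g0) => //; exact: measurable_itv.
Qed.

Lemma hitting_time_measurable : measurable_fun setT tau.
Proof.
apply: (measurability (@RGenOInfty.G R)) => [|/= _ [_] [s] -> <-].
  exact: RGenOInfty.measurableE.
rewrite setTI; have [s0|s0] := ltP s 0.
  rewrite (_ : _ @^-1` _ = setT); first exact: measurableT.
  apply/seteqP; split => // w _ /=; rewrite in_itv/= andbT.
  exact: lt_le_trans (hitting_time_ge0 w).
pose never : set T := [set w | hits w = set0].
have -> : tau @^-1` `]s, +oo[%classic =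
    ~` [set w | exists2 t, hits w t & t <= s] `&` ~` never.
  apply/seteqP; split => w /=; rewrite in_itv/= andbT.
    move=> st; split; first by move=> [t ht ts]; have := hitting_time_le ht; lra.
    by move=> e; move: st; rewrite /tau e inf0; lra.
  move=> [h1 /eqP/set0P ne]; rewrite ltNge; apply/negP => ts.
  by apply: h1; exists (tau w) => //; exact: hits_hitting_time.
apply: measurableI; apply: measurableC; first exact: hit_before_measurable.
have -> : never = \bigcap_n ~` [set w | exists2 t, hits w t & t <= n%:R].
  apply/seteqP; split => w.
    by move=> e n _ [t]; rewrite e.
  move=> H; apply/seteqP; split => // t ht.
  have [t0 _] := ht.
  apply: (H (Num.truncn t).+1 I); exists t => //; exact/ltW/truncnS_gt.
apply: bigcap_measurable => // n _; apply: measurableC; exact: hit_before_measurable.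
Qed.

(** The value at the hitting time is the limit of the values at the next point
    of the grid of mesh 1 / (m + 1), which is a time with countably many
    values. *)
Lemma stopped_value_measurable : measurable_fun setT (fun w => X (tau w) w).
Proof.
pose idx m w := Num.truncn (tau w * m.+1%:R).
pose Y m w := X ((idx m w).+1%:R / m.+1%:R) w.
have tm0 m w : 0 <= tau w * m.+1%:R by rewrite mulr_ge0// hitting_time_ge0.
apply: (@measurable_fun_cvg _ _ _ setT Y) => [m|w _].
  move=> _ B mB; rewrite setTI.
  have -> : Y m @^-1` B = \bigcup_k ((fun w => tau w * m.+1%:R) @^-1`
      `[k%:R, k.+1%:R[%classic `&` X (k.+1%:R / m.+1%:R) @^-1` B).
    apply/seteqP; split => w.
      move=> Bw; exists (idx m w) => //; split => //=.
      by rewrite in_itv/=; exact: truncn_itv.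
    move=> [k _ [/=]]; rewrite in_itv/= => hk.
    have ik : idx m w = k by apply/eqP; rewrite truncn_eq.
    by rewrite /Y ik.
  apply: bigcup_measurable => k _; apply: measurableI.
    have mf : measurable_fun setT (fun w => tau w * m.+1%:R).
      by apply: measurable_funM => //; exact: hitting_time_measurable.
    by rewrite -[X in measurable X]setTI; apply: mf => //; exact: measurable_itv.
  have g0 : 0 <= k.+1%:R / m.+1%:R :> R by rewrite divr_ge0.
  by rewrite -[X in measurable X]setTI; apply: (X_meas g0).
apply/cvgrPdist_lt => e e0.
have [r r0 hr] := within_continuous_eps (@X_cont w) (hitting_time_ge0 w) e0.
exists (Num.truncn r^-1) => // m /= hm.
rewrite distrC; apply: hr; first by rewrite divr_ge0.
have m0 : 0 < m.+1%:R :> R by rewrite ltr0n.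
have /andP[h1 h2] := truncn_itv (tm0 m w).
rewrite -/(idx m w) in h1 h2.
have im : m.+1%:R^-1 < r.
  rewrite -[ltRHS]invrK ltf_pV2 ?posrE ?invr_gt0//.
  by apply: lt_le_trans (truncnS_gt _) _; rewrite ler_nat.
have l1 : tau w < (idx m w).+1%:R / m.+1%:R by rewrite ltr_pdivlMr.
have l2 : (idx m w)%:R / m.+1%:R <= tau w by rewrite ler_pdivrMr.
rewrite ger0_norm ?subr_ge0; last exact: ltW.
rewrite -[(idx m w).+1%:R]natr1 mulrDl mul1r; move: l2 im.
by move: ((idx m w)%:R / m.+1%:R) => u; move: (m.+1%:R^-1) => v; lra.
Qed.

End StoppedValue.

(** * The exit law of the slit square *)

Section ExitLaw.
Context (R : realType) d (T : measurableType d) (P : probability T R).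
Variable Z : R -> T -> R[i].
Hypothesis bmZ : is_planar_brownian_motion P Z.
Let X t w := complex.Re (Z t w).
Let Y t w := complex.Im (Z t w).
Let bmX : is_brownian_motion P X. Proof. by case: bmZ. Qed.
Let bmY : is_brownian_motion P Y. Proof. by case: bmZ. Qed.
Variables (h t c : R).
Hypothesis h01 : 0 < h < 1.
Hypothesis t0 : 0 < t.
Hypothesis c0 : 0 < c.
Hypothesis c_small : 10 * c < 2^-1.

Let G s w := depth h (X s w) (Y s w).

Let X0 w : X 0 w = 0. Proof. by case: bmX. Qed.
Let Y0 w : Y 0 w = 0. Proof. by case: bmY. Qed.
Let X_cont w : {within `[0, +oo[, continuous (fun s => X s w)}.
Proof. by case: bmX => _ _ + _ _; apply. Qed.
Let Y_cont w : {within `[0, +oo[, continuous (fun s => Y s w)}.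
Proof. by case: bmY => _ _ + _ _; apply. Qed.

Let G_cont w : {within `[0, +oo[, continuous (fun s => G s w)}.
Proof.
apply/subspace_continuousP => s; rewrite /= in_itv/= andbT => s0.
apply/cvgrPdist_lt => e e0.
have e2 : 0 < e / 2 by rewrite divr_gt0.
have [r1 r10 h1] := within_continuous_eps (@X_cont w) s0 e2.
have [r2 r20 h2] := within_continuous_eps (@Y_cont w) s0 e2.
rewrite /prop_near1 /within/=; apply/nbhs_ballP; exists (Num.min r1 r2).
  by rewrite /= lt_min r10 r20.
move=> u; rewrite /ball/= distrC lt_min => /andP[u1 u2].
rewrite in_itv/= andbT => u0; rewrite distrC.
apply: le_lt_trans (depth_lipschitz _ _ _ _ _) _.
by have := h1 u u0 u1; have := h2 u u0 u2; lra.
Qed.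

Let G_meas s : 0 <= s -> measurable_fun setT (G s).
Proof.
move=> s0; have mX : measurable_fun setT (X s) by exact: (bm_measurable bmX).
have mY : measurable_fun setT (Y s) by exact: (bm_measurable bmY).
have nX : measurable_fun setT (fun w => `|X s w|).
  exact: measurableT_comp (@normr_measurable R setT) mX.
have nY : measurable_fun setT (fun w => `|Y s w|).
  exact: measurableT_comp (@normr_measurable R setT) mY.
apply: measurable_minr; first apply: measurable_minr.
- exact: measurable_funB.
- exact: measurable_funB.
apply: measurable_maxr; last exact: measurable_funB.
apply: (measurableT_comp (@normr_measurable R setT)); exact: measurable_funB.
Qed.

Let G_le0 s w : G s w <= 0 <-> ~ slit_square h (Z s w).
Proof.
split; first by move=> g /(depth_gt0 h); rewrite ltNge g.
by move=> n; rewrite leNgt; apply/negP => /(depth_gt0 h).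
Qed.

Let W w := X (hitting_time G w) w.

Lemma exit_lawE A : exit_law P Z (slit_square h) A = P (W @^-1` A).
Proof.
suff -> : W = (fun w => complex.Re (Z (exit_time Z (slit_square h) w) w)) by [].
apply/funext => w; rewrite /W; congr (X _ w); rewrite /exit_time /hitting_time.
by congr inf; apply/seteqP; split => s /= [s0 hs]; split => //; apply/G_le0.
Qed.

Let W_event x : measurable (W @^-1` `]-oo, x]).
Proof.
rewrite -[X in measurable X]setTI.
have mW := stopped_value_measurable (@G_cont) (@X_cont) (@G_meas)
  (fun s s0 => bm_measurable bmX s0).
exact: (mW measurableT _ (measurable_itv _)).
Qed.

Let W_le1 w : `|W w| <= 1.
Proof.
have [ne|/set0P/negP/negPn/eqP e] := pselect (hits G w !=set0); last first.
  by rewrite /W /hitting_time e inf0 X0 normr0.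
have [ht0 Gt] := hits_hitting_time G_cont ne.
have tp : 0 < hitting_time G w.
  rewrite lt_neqAle ht0 andbT; apply/eqP => E.
  by move: Gt; rewrite -E leNgt /G X0 Y0; move/negP; apply; apply/(depth_gt0 h 0)/slit_square0.
rewrite leNgt; apply/negP => big.
have e0 : 0 < `|W w| - 1 by rewrite subr_gt0.
have [r r0 hr] := within_continuous_eps (@X_cont w) ht0 e0.
(* A time just before the exit, at which the path is still in the square. *)
pose s := Num.max 0 (hitting_time G w - r / 2).
have s0 : 0 <= s by rewrite /s le_max lexx.
have st : s < hitting_time G w by rewrite /s gt_max tp; lra.
have sr : `|s - hitting_time G w| < r.
  rewrite distrC ger0_norm ?subr_ge0 ?ltW//.
  have : hitting_time G w - r / 2 <= s by rewrite /s le_max lexx orbT.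
  lra.
have Us : slit_square h (Z s w).
  apply: contrapT => /G_le0 g.
  by have := hitting_time_le (conj s0 g); rewrite leNgt st.
have [x1 _ _] := Us.
have := hr s s0 sr; have := ler_normD (X s w - W w) (- X s w).
rewrite addrAC subrr add0r !normrN -/(X s w) -/(W w) in x1 *; lra.
Qed.

(** Off this event the path hits a slit before time t and before its real part
    exceeds 10 c. *)
Definition late_or_far : set T := [set w | `|Y t w| < h] `|` some_big_jump X t c.

Let confined_measurable : measurable [set w | `|Y t w| < h].
Proof.
rewrite -[X in measurable X]setTI.
exact: (bm_measurable bmY (ltW t0) measurableT (measurable_normr_lt h)).
Qed.

Lemma late_or_far_measurable : measurable late_or_far.
Proof.
by apply: measurableU; [exact: confined_measurable|exact: (some_big_jump_measurable bmX c t0)].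
Qed.

Lemma late_or_far_le : (P late_or_far <= (2 * h / Num.sqrt t + 320 * t ^+ 2 / c ^+ 4)%:E)%E.
Proof.
have h0 : 0 < h by case/andP: h01.
apply: le_trans (measureU2 _ _ _) _.
- exact: confined_measurable.
- exact: (some_big_jump_measurable bmX c t0).
rewrite EFinD; apply: leeD; first exact: (bm_center bmY t0 h0).
exact: (some_big_jump_le bmX t0 c0).
Qed.

(** Since |Y| is 0 at time 0 and at least h at time t, it equals h at some time
    in between, and then the real part is still less than 1/2: the path is on a
    slit. *)
Lemma exit_near_axis w : ~ late_or_far w -> `|W w| <= 10 * c.
Proof.
move=> nb; have h0 : 0 < h by case/andP: h01.
have Yt : h <= `|Y t w| by rewrite leNgt; apply/negP => y; apply: nb; left.
have path : forall s, 0 <= s <= t -> `|X s w| <= 10 * c.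
  by apply: (path_bound bmX t0 c0) => j; apply: nb; right.
have cY : {within `[0, t], continuous (fun s => `|Y s w|)}.
  have sub : {within `[0, t], continuous (fun s => Y s w)}.
    apply: continuous_subspaceW (@Y_cont w).
    by move=> s /=; rewrite !in_itv/= andbT => /andP[].
  by move=> s; apply: continuous_comp (sub s) (@norm_continuous _ R^o _).
have hv : Num.min `|Y 0 w| `|Y t w| <= h <= Num.max `|Y 0 w| `|Y t w|.
  by rewrite Y0 normr0 min_l ?normr_ge0// max_r ?normr_ge0// Yt (ltW h0).
have [s] := @IVT _ (fun s => `|Y s w|) 0 t h (ltW t0) cY hv.
rewrite in_itv/= => /andP[s0 st] Ys.
have hit : hits G w s.
  split => //; apply/G_le0 => -[_ _]; rewrite -/(Y s w) Ys eqxx => -[//|].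
  have := path s; rewrite s0 st => /(_ isT); rewrite ler_norml => /andP[_ l] g.
  by have := lt_trans c_small (lt_le_trans g l); rewrite ltxx.
by apply: path; rewrite hitting_time_ge0/=; exact: le_trans (hitting_time_le hit) st.
Qed.

Variable delta : R.
Hypothesis delta_bound : 2 * h / Num.sqrt t + 320 * t ^+ 2 / c ^+ 4 <= delta.

Let late_or_far_le_delta : (P late_or_far <= delta%:E)%E.
Proof. by apply: le_trans late_or_far_le _; rewrite lee_fin. Qed.

Local Notation law := (exit_law P Z (slit_square h)).

Lemma exit_law_hi : (1%:E <= law `]-oo, 1%R]%classic)%E.
Proof.
rewrite exit_lawE (_ : _ @^-1` _ = setT) ?probability_setT//.
by apply/seteqP; split => // w _; rewrite /= in_itv/=; exact: le_trans (ler_norm _) (W_le1 w).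
Qed.

Lemma exit_law_lo x : x < -1 -> (law `]-oo, x]%classic <= 0)%E.
Proof.
move=> x1; rewrite exit_lawE (_ : _ @^-1` _ = set0) ?measure0//.
apply/seteqP; split => // w; rewrite /= in_itv/= => wx.
by have := W_le1 w; rewrite ler_norml => /andP[]; lra.
Qed.

Lemma exit_law_mid : ((1 - delta)%:E <= law `]-oo, (10 * c)%R]%classic)%E.
Proof.
rewrite exit_lawE; apply: (@le_trans _ _ (P (~` late_or_far))).
  rewrite probability_setC ?late_or_far_measurable//; last exact: late_or_far_measurable.
  by rewrite EFinB leeB.
apply: le_measure; rewrite ?inE.
- exact: measurableC late_or_far_measurable.
- exact: W_event.
- by move=> w nb; rewrite /= in_itv/=; exact: le_trans (ler_norm _) (exit_near_axis nb).
Qed.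

Lemma exit_law_left x : x < - (10 * c) -> (law `]-oo, x]%classic <= delta%:E)%E.
Proof.
move=> xc; rewrite exit_lawE; apply: le_trans late_or_far_le_delta.
apply: le_measure; rewrite ?inE.
- exact: W_event.
- exact: late_or_far_measurable.
- move=> w; rewrite /= in_itv/= => wx; apply: contrapT => /exit_near_axis.
  by rewrite ler_norml => /andP[]; lra.
Qed.

End ExitLaw.

Theorem theorem3 (R : realType) :
  exists U : set R[i]^o,
    [/\ is_domain U, bounded_set U, U 0
      & forall (d : measure_display) (T : measurableType d)
               (P : probability T R) (Z : R -> T -> R[i]),
          is_planar_brownian_motion P Z ->
          brownian_symmetrization P Z U <> steiner_symmetrization U].
Proof.
have [c [c0 c1]] : exists c : R, 0 < c /\ 20 * c <= 1 / 128.
  by exists (1 / 2560); split; lra.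
(* The choice of t makes 320 t^2 / c^4 less than 1/1024, and that of h makes
   2 h / sqrt t equal to 1/1024; the accuracy 10 c and the mass 1/512 then meet
   the requirement 2 * eps + 4 * delta <= 1/64 of the analytic part. *)
pose t : R := (c / 32) ^+ 2; pose h : R := c / 64 / 1024.
have h01 : 0 < h < 1 by rewrite /h; apply/andP; split; lra.
have t0 : 0 < t by rewrite exprn_gt0//; lra.
have cs : 10 * c < 2^-1 by lra.
have U0 := slit_square0 h01.
exists (slit_square h); split.
- by split; [exists 0|exact: slit_square_open|exact: slit_square_connected].
- exact: slit_square_bounded.
- exact: U0.
move=> d T P Z bmZ E.
have delta_bound : 2 * h / Num.sqrt t + 320 * t ^+ 2 / c ^+ 4 <= 1 / 512.
  have c32 : 0 <= c / 32 by lra.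
  rewrite /t sqrtr_sqr (ger0_norm c32).
  have -> : 2 * h / (c / 32) = 1 / 1024 by rewrite /h; field; rewrite gt_eqF.
  have -> : 320 * (c / 32) ^+ 2 ^+ 2 / c ^+ 4 = 320 / 32 ^+ 4.
    by field; rewrite gt_eqF.
  lra.
have [|||w [w1 w2]] := @gross_domain_misses R (exit_law P Z (slit_square h)) (10 * c) (1 / 512)
  _ _ (exit_law_hi bmZ h01) (exit_law_lo bmZ h01)
  (exit_law_mid bmZ h01 t0 c0 cs delta_bound) (exit_law_left bmZ h01 t0 c0 cs delta_bound).
- by rewrite mulr_ge0// ltW.
- by apply/andP; split; lra.
- lra.
apply; rewrite -/(brownian_symmetrization P Z (slit_square h)) E.
exact: steiner_slit_square.
Qed.
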